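(* There exists a universal constant $C>0$ such that the following holds for every positive integer $n$, every $\sigma>0$ and every $\theta^*\in K_n$. (i) For every $x>0$, with probability greater than $1-\exp(-x)-\exp(-x^2/16)$, $$\frac1n\|\hat\theta-\theta^*\|^2\le \frac1n\sigma^2(2+17x)+C\,\sigma^{8/5}\big(V((I-P_L)\theta^* )+\sigma\big)^{2/5}n^{-4/5}.$$ (ii) Moreover, $$R(\hat\theta,\theta^* )\le C\,\sigma^{8/5}\big(V((I-P_L)\theta^* )+\sigma\big)^{2/5}n^{-4/5}+\frac{2\sigma^2}{n}.$$
   Context: $K_n=\{\theta\in\mathbb{R}^n:\ \theta_i-\theta_{i-1}\ge\theta_{i+1}-\theta_i \text{ for all } 2\le i\le n-1\}$ is the closed convex cone of concave sequences (for $n\le 2$ the condition is vacuous and $K_n=\mathbb{R}^n$). One observes $y=\theta^*+z$, where $z=(z_1,\dots,z_n)$ has i.i.d. $N(0,\sigma^2)$ entries. $\|\cdot\|$ is the Euclidean norm on $\mathbb{R}^n$. The least squares estimator is $\hat\theta=\operatorname{argmin}_{\theta\in K_n}\|y-\theta\|^2$ (the Euclidean projection of $y$ onto $K_n$), and its risk is $R(\hat\theta,\theta^* )=\mathbb{E}\,\frac1n\|\hat\theta-\theta^*\|^2$, the expectation being over $y$. $L$ is the linear subspace of $\mathbb{R}^n$ spanned by $(1,\dots,1)$ and $(1,2,\dots,n)$, $P_L$ is the orthogonal projection matrix onto $L$, and $I$ is the identity matrix. For $\theta\in\mathbb{R}^n$, $V(\theta)=\max_{1\le i\le n}\theta_i-\min_{1\le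 i\le n}\theta_i$. A universal constant is one that does not depend on any of the other quantities. *)

(* Defs.v *)
From HB Require Import structures.
From mathcomp Require Import all_boot all_order all_algebra.
From mathcomp Require Import all_classical all_reals all_analysis.
Set Implicit Arguments.
Unset Strict Implicit.
Unset Printing Implicit Defensive.
Import Order.TTheory GRing.Theory Num.Theory.

Local Open Scope classical_set_scope.
Local Open Scope ring_scope.

(* The library norm on 'rV[R]_n is the sup norm, hence this definition. *)
Definition enorm (R : realType) (n : nat) (u : 'rV[R]_n) : R :=
  Num.sqrt (\sum_(i < n) u 0 i ^+ 2).

Definition concave_cone (R : realType) (n : nat) : set 'rV[R]_n :=
  [set t | forall i j k : 'I_n, nat_of_ord j = i.+1 -> nat_of_ord k = j.+1 ->
     t 0 k - t 0 j <= t 0 j - t 0 i].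

(* The set of minimizers is a singleton, as concave_cone is closed, convex and
   nonempty; the default value 0 of xget plays no role. *)
Definition lse (R : realType) (n : nat) (y : 'rV[R]_n) : 'rV[R]_n :=
  xget 0 [set t | concave_cone t /\
    forall u, concave_cone u -> enorm (y - t) ^+ 2 <= enorm (y - u) ^+ 2].

(* Row space spanned by (1, ..., 1) and (1, 2, ..., n); indices start at 0. *)
Definition affine_space (R : realType) (n : nat) : 'M[R]_n :=
  ((const_mx 1 : 'rV[R]_n) + \row_(i < n) (i.+1)%:R)%MS.

(* Projection onto the row space of U along its orthogonal complement, acting
   on row vectors by right multiplication; same construction as proj_ortho,
   which is only available over the complex numbers. *)
Definition orth_proj (R : realType) (n : nat) (U : 'M[R]_n) : 'M[R]_n :=
  proj_mx U (kermx U^T).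

Definition PL (R : realType) (n : nat) : 'M[R]_n := orth_proj (affine_space R n).

Definition spread (R : realType) (n : nat) (t : 'rV[R]_n.+1) : R :=
  \big[Num.max/t 0 ord0]_(i < n.+1) t 0 i
  - \big[Num.min/t 0 ord0]_(i < n.+1) t 0 i.

Definition mutually_independent d (T : measurableType d) (R : realType)
    (P : probability T R) (n : nat) (z : 'I_n -> {RV P >-> R}) : Prop :=
  forall (J : {set 'I_n}) (A : 'I_n -> set R),
    (forall i, measurable (A i)) ->
    P (\bigcap_(i in [set` J]) (z i @^-1` A i)) =
    (\prod_(i in J) P (z i @^-1` A i))%E.

(* normal_prob takes the standard deviation, so this is N(0, sigma^2). *)
Definition iid_gaussian d (T : measurableType d) (R : realType)
    (P : probability T R) (n : nat) (sigma : R)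
    (z : 'I_n -> {RV P >-> R}) : Prop :=
  mutually_independent z /\
  forall i (A : set R), measurable A ->
    distribution P (z i) A = normal_prob 0 sigma A.

(* The observation is y = t + z. *)
Definition lse_loss d (T : measurableType d) (R : realType)
    (P : probability T R) (n : nat) (t : 'rV[R]_n)
    (z : 'I_n -> {RV P >-> R}) (w : T) : R :=
  n%:R^-1 * enorm (lse (t + \row_(i < n) z i w) - t) ^+ 2.

Definition lse_risk d (T : measurableType d) (R : realType)
    (P : probability T R) (n : nat) (t : 'rV[R]_n)
    (z : 'I_n -> {RV P >-> R}) : \bar R :=
  'E_P[lse_loss t z].

(* Main.v *)
(* The error d = lse(y) - theta satisfies |d|^2 <= <z, d>, because lse(y) is a
   projection onto a convex set, and d is a difference of two concave
   sequences; subtracting an affine sequence from both changes neither d nor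
   concavity, so theta may be replaced by (I - P_L) theta, whose entries differ
   by at most V.  No entropy bound is needed: expand <z, d> in Alpert
   multiwavelets, an orthonormal system of locally supported vectors with two
   vanishing moments.  Since the slopes of a concave sequence decrease, its
   wavelet coefficients at a given level satisfy an l1 bound, so
     <z, d> <= |d|^2 / 2 + (1/2) sum_e max(0, |z_e| - tau_e)^2 + sum_e tau_e |d_e|
   with thresholds tau_e vanishing at coarse levels and growing linearly with
   the level beyond the critical one gives the rate n^(1/5) V^(2/5) without
   logarithms.  To keep the slopes under control near the two ends, the
   wavelets live on blocks whose length is at most their distance to the ends.
   Finally |d|^2 has a finite exponential moment, because
   exp((2/17) max(0, |x| - tau)^2) <= 1 + exp(-(2/17) tau^2) exp((2/17) x^2);
   Markov's inequality gives (i), and y <= exp y gives (ii). *)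
Require Import Defs.
From HB Require Import structures.
From mathcomp Require Import all_boot all_order all_algebra.
From mathcomp Require Import all_classical all_reals all_analysis.
From mathcomp Require Import measurable_realfun zify ring lra.
Import Order.TTheory GRing.Theory Num.Theory.
Import numFieldNormedType.Exports HBNNSimple.
Local Open Scope classical_set_scope.
Local Open Scope ring_scope.
Set Implicit Arguments.
Unset Strict Implicit.
Unset Printing Implicit Defensive.

(** * Alpert multiwavelets *)

Definition ip (R : rcfType) (n : nat) (e f : nat -> R) : R :=
  \sum_(x < n) e x * f x.

Definition sqrt2 (R : rcfType) : R := Num.sqrt 2.

Lemma sqrt2_sqr (R : rcfType) : sqrt2 R ^+ 2 = 2.
Proof. by rewrite sqr_sqrtr. Qed.

Lemma sqrt2_gt0 (R : rcfType) : 0 < sqrt2 R.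
Proof. by rewrite sqrtr_gt0. Qed.

Lemma sqrt2X_sqr (R : rcfType) (k : nat) : (sqrt2 R ^+ k) ^+ 2 = (2 ^ k)%:R.
Proof. by rewrite exprAC sqrt2_sqr natrX. Qed.

(* The Euclidean norm of the centred identity on an interval of length 2^k. *)
Fixpoint kappa (R : rcfType) (k : nat) : R :=
  if k is k'.+1
  then Num.sqrt (2 * kappa R k' ^+ 2 + (sqrt2 R ^+ k') ^+ 6 / 2) else 0.

(** With [alpert_sin], the coordinates of the normalized centred identity of a block in the
    orthonormal pair (q_left + q_right) / sqrt 2, (p_right - p_left) / sqrt 2: each half contributes
    its own centred identity, and its centre lies 2^k / 2 away from that of the parent. *)
Definition alpert_cos (R : rcfType) (k : nat) : R :=
  sqrt2 R * kappa R k / kappa R k.+1.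

Definition alpert_sin (R : rcfType) (k : nat) : R :=
  (sqrt2 R ^+ k) ^+ 3 / (sqrt2 R * kappa R k.+1).

Lemma kappa_sqr (R : rcfType) (k : nat) :
  kappa R k.+1 ^+ 2 = 2 * kappa R k ^+ 2 + (sqrt2 R ^+ k) ^+ 6 / 2.
Proof.
have r0 := sqrt2_gt0 R.
have h0 : 0 <= (sqrt2 R ^+ k) ^+ 6 / 2 by rewrite divr_ge0// exprn_ge0//
  exprn_ge0// ltW.
by rewrite /= sqr_sqrtr// addr_ge0// mulr_ge0// sqr_ge0.
Qed.

Lemma kappa_gt0 (R : rcfType) (k : nat) : 0 < kappa R k.+1.
Proof.
have h0 : 0 < (sqrt2 R ^+ k) ^+ 6 / 2.
  by rewrite divr_gt0// exprn_gt0// exprn_gt0// sqrt2_gt0.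
by rewrite /= sqrtr_gt0; apply: (lt_le_trans h0);
  rewrite lerDr mulr_ge0// sqr_ge0.
Qed.

Lemma alpert_cos_sin (R : rcfType) (k : nat) :
  alpert_cos R k ^+ 2 + alpert_sin R k ^+ 2 = 1.
Proof.
have := kappa_gt0 R k; have := kappa_sqr R k; have := sqrt2_sqr R;
  have := sqrt2_gt0 R.
rewrite /alpert_cos /alpert_sin; move: (sqrt2 R ^+ k) => h.
move: (sqrt2 R) (kappa R k.+1) (kappa R k) => r K K' r0 r2 KE K0.
have -> : (r * K' / K) ^+ 2 + (h ^+ 3 / (r * K)) ^+ 2 =
    (r ^+ 2 * K' ^+ 2 + h ^+ 6 / r ^+ 2) / K ^+ 2 by field; rewrite !gt_eqF.
by rewrite r2 -KE divff// gt_eqF// exprn_gt0.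
Qed.

(* On the block [a, a + 2^k), pvec and qvec are the normalized constant and the
   normalized centred identity.  Together with wvec1 and wvec2, those of the
   block of length 2^k.+1 arise from those of its two halves by a rotation. *)
Fixpoint pvec (R : rcfType) (k a x : nat) : R :=
  if k is k'.+1 then (pvec R k' a x + pvec R k' (a + 2 ^ k') x) / sqrt2 R
  else (x == a)%:R.

Fixpoint qvec (R : rcfType) (k a x : nat) : R :=
  if k is k'.+1 then
    (alpert_cos R k' * (qvec R k' a x + qvec R k' (a + 2 ^ k') x)
     + alpert_sin R k' * (pvec R k' (a + 2 ^ k') x - pvec R k' a x)) / sqrt2 R
  else 0.

Definition wvec1 (R : rcfType) (k a x : nat) : R :=
  (qvec R k a x - qvec R k (a + 2 ^ k) x) / sqrt2 R.

Definition wvec2 (R : rcfType) (k a x : nat) : R :=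
  (alpert_sin R k * (qvec R k a x + qvec R k (a + 2 ^ k) x)
   - alpert_cos R k * (pvec R k (a + 2 ^ k) x - pvec R k a x)) / sqrt2 R.

(** Each vector carries its threshold, which depends on the scale only, so one list serves both the
    sums over vectors and the sums over thresholds. *)
Fixpoint wavelets (R : rcfType) (tau : nat -> R) (k a : nat) :
    seq ((nat -> R) * R) :=
  if k is k'.+1 then
    (wvec1 R k' a, tau k') :: (wvec2 R k' a, tau k') ::
    wavelets tau k' a ++ wavelets tau k' (a + 2 ^ k')
  else [::].

Definition block_frame (R : rcfType) (tau : nat -> R) (k a : nat) :=
  (pvec R k a, 0) :: (qvec R k a, 0) :: wavelets tau k a.

(** Orthonormality in the form of a resolution of the identity. In the induction, p, q and the two
    wavelets of a block are an orthogonal transform of p and q of its halves, which preserves the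
    sum of e(x) e(y). *)
Lemma block_frame_kernel (R : rcfType) (tau : nat -> R) (k a x y : nat) :
  \sum_(e <- block_frame tau k a) e.1 x * e.1 y =
  ((x == y) && (a <= x < a + 2 ^ k)%N)%:R.
Proof.
rewrite /block_frame !big_cons /=; elim: k a => [|k ih] a /=.
  rewrite big_nil expn0 addn1 ltnS -eqn_leq mul0r !addr0 -natrM mulnb.
  by congr (_%:R); lia.
rewrite !big_cons big_cat /=.
have H1 := ih a; have H2 := ih (a + 2 ^ k)%N.
have -> : ((x == y) && (a <= x < a + 2 ^ k.+1)%N)%:R =
    ((x == y) && (a <= x < a + 2 ^ k)%N)%:R +
    ((x == y) && (a + 2 ^ k <= x < a + 2 ^ k + 2 ^ k)%N)%:R :> R.
  by rewrite -natrD expnS; congr (_%:R); lia.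
rewrite -H1 -H2 /wvec1 /wvec2.
set s1 := \sum_(e <- _) _; set s2 := \sum_(e <- _) _.
have := alpert_cos_sin R k; have := sqrt2_sqr R; have := sqrt2_gt0 R.
move: (sqrt2 R) (alpert_cos R k) (alpert_sin R k) => r c s r0 r2 cs.
move: (pvec R k a x) (pvec R k a y) (qvec R k a x) (qvec R k a y) => p1 p1' q1
  q1'.
move: (pvec R k _ x) (pvec R k _ y) (qvec R k _ x) (qvec R k _ y) => p2 p2' q2
  q2'.
transitivity (((c ^+ 2 + s ^+ 2) * ((q1 + q2) * (q1' + q2') + (p2 - p1) * (p2'
  - p1'))
  + (q1 - q2) * (q1' - q2') + (p1 + p2) * (p1' + p2')) / r ^+ 2 + s1 + s2).
  by field; rewrite gt_eqF.
by rewrite cs r2; field.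
Qed.

Lemma ip_comb4 (R : rcfType) (n : nat) (c1 c2 c3 c4 : R)
    (e1 e2 e3 e4 e f : nat -> R) :
  (forall x, e x = c1 * e1 x + c2 * e2 x + c3 * e3 x + c4 * e4 x) ->
  ip n e f = c1 * ip n e1 f + c2 * ip n e2 f + c3 * ip n e3 f + c4 * ip n e4 f.
Proof.
move=> eE; rewrite /ip !mulr_sumr -!big_split /=; apply: eq_bigr => x _.
by rewrite eE; ring.
Qed.

Lemma ipBr (R : rcfType) (n : nat) (e f g : nat -> R) :
  ip n e (fun x => f x - g x) = ip n e f - ip n e g.
Proof. by rewrite /ip -sumrB; apply: eq_bigr => x _; rewrite mulrBr. Qed.

Lemma ip_affine (R : rcfType) (n : nat) (e : nat -> R) (c d : R) :
  ip n e (fun x => c + d * x%:R) =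
  c * ip n e (fun=> 1) + d * ip n e (fun x => x%:R).
Proof. by rewrite /ip !mulr_sumr -big_split /=; apply: eq_bigr => x _;
  ring. Qed.

Lemma ip_delta (R : rcfType) (n a : nat) (f : nat -> R) : (a < n)%N ->
  ip n (fun x => (x == a)%:R) f = f a.
Proof.
move=> an; rewrite /ip (bigD1 (Ordinal an))//= eqxx mul1r big1 ?addr0// => i ia.
by rewrite (_ : (i == a :> nat) = false) ?mul0r//; apply: negbTE.
Qed.

(** These moments yield the two vanishing moments of the wavelets. The first moment of [pvec] is its
    mass times the centre of the block; that of [qvec] is the norm of the centred identity. *)
Lemma pqvec_moments (R : rcfType) (n k a : nat) : (a + 2 ^ k <= n)%N ->
  [/\ ip n (pvec R k a) (fun=> 1) = sqrt2 R ^+ k,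
      ip n (pvec R k a) (fun x => x%:R) =
        sqrt2 R ^+ k * (a%:R + ((sqrt2 R ^+ k) ^+ 2 - 1) / 2),
      ip n (qvec R k a) (fun=> 1) = 0 &
      ip n (qvec R k a) (fun x => x%:R) = kappa R k].
Proof.
elim: k a => [|k ih] a an.
  have {}an : (a < n)%N by lia.
  rewrite !ip_delta// !expr0 expr1n subrr mul0r addr0 mul1r; split => //.
    by rewrite /ip big1// => i _; rewrite mul0r.
  by rewrite /ip big1// => i _; rewrite mul0r.
have a1 : (a + 2 ^ k <= n)%N by rewrite expnS in an; lia.
have a2 : (a + 2 ^ k + 2 ^ k <= n)%N by rewrite expnS in an; lia.
have [P1 PX Q1 QX] := ih a a1; have [P1' PX' Q1' QX'] := ih _ a2.
set i := (sqrt2 R)^-1; pose c := alpert_cos R k; pose s := alpert_sin R k.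
have pE f : ip n (pvec R k.+1 a) f =
    i * ip n (pvec R k a) f + i * ip n (pvec R k (a + 2 ^ k)) f + 0 * ip n
      (qvec R k a) f + 0 * ip n (qvec R k a) f.
  by apply: ip_comb4 => x /=; rewrite -/i; ring.
have qE f : ip n (qvec R k.+1 a) f =
    (- s * i) * ip n (pvec R k a) f + s * i * ip n (pvec R k (a + 2 ^ k)) f +
    c * i * ip n (qvec R k a) f + c * i * ip n (qvec R k (a + 2 ^ k)) f.
  by apply: ip_comb4 => x /=; rewrite -/i -/c -/s; ring.
rewrite !pE !qE P1 PX Q1 QX P1' PX' Q1' QX' natrD -sqrt2X_sqr exprS.
rewrite /i {i pE qE} /c /s {c s} /alpert_cos /alpert_sin.
have := kappa_gt0 R k; have := kappa_sqr R k; have := sqrt2_sqr R;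
  have := sqrt2_gt0 R.
move: (sqrt2 R ^+ k) {P1 PX P1' PX' Q1 QX Q1' QX'} => h.
move: (sqrt2 R) (kappa R k.+1) (kappa R k) => r K K' r0 r2 KE K0.
have r0' := lt0r_neq0 r0; have K0' := lt0r_neq0 K0.
have ri : r^-1 = r / 2.
  by apply: (mulfI r0'); rewrite divff// mulrA -expr2 r2 divff// pnatr_eq0.
split.
- by rewrite ri; field.
- by rewrite exprMn r2 ri; field.
- by ring.
- transitivity ((2 * K' ^+ 2 + h ^+ 6 / r ^+ 2) / K); first by field;
    rewrite r0' K0'.
  by rewrite r2 -KE expr2 mulfK.
Qed.

Lemma frame_parseval (R : rcfType) (n : nat) (E : seq ((nat -> R) * R))
    (D : pred nat) :
  (forall x y, \sum_(e <- E) e.1 x * e.1 y = ((x == y) && D x)%:R) ->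
  forall f g, \sum_(e <- E) ip n e.1 f * ip n e.1 g = \sum_(x < n | D x) f x *
    g x.
Proof.
move=> KE f g; rewrite /ip.
transitivity (\sum_(x < n) \sum_(y < n) (\sum_(e <- E) e.1 x * e.1 y) * (f x *
  g y)).
  under eq_bigr do rewrite mulr_suml.
  rewrite exchange_big; apply: eq_bigr => x _ /=.
  under eq_bigr do rewrite mulr_sumr.
  rewrite exchange_big; apply: eq_bigr => y _ /=.
  by rewrite mulr_suml; apply: eq_bigr => e _; ring.
rewrite [RHS]big_mkcond; apply: eq_bigr => x _.
rewrite (bigD1 x)//= KE eqxx /= big1 ?addr0; last first.
  by move=> y yx; rewrite KE (_ : (x == y :> nat) = false) ?mul0r// eq_sym;
    apply: negbTE.
by case: (D x); rewrite ?mul1r ?mul0r.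
Qed.

Lemma sum_interval (R : rcfType) (n a N : nat) (f : nat -> R) : (a + N
  <= n)%N ->
  \sum_(x < n | (a <= x < a + N)%N) f x = \sum_(i < N) f (a + i)%N.
Proof.
move=> aN; rewrite -(big_mkord (fun x => a <= x < a + N)%N).
rewrite (@big_cat_nat _ _ _ a)//=; last by lia.
rewrite big1_seq ?add0r; last first.
  by move=> x /=; rewrite mem_index_iota; lia.
rewrite (@big_cat_nat _ _ _ (a + N))//=; last by lia.
rewrite [X in _ + X]big1_seq ?addr0; last first.
  by move=> x /=; rewrite mem_index_iota; lia.
rewrite big_nat_cond (eq_bigl (fun x => (a <= x < a + N) && true)%N);
  last first.
  by move=> x; rewrite andbb andbT.
rewrite -big_nat_cond -{1}[a]add0n big_addn addKn big_mkord.
by apply: eq_bigr => i _; rewrite addnC.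
Qed.

(** Wavelets annihilate affine sequences, so f may be replaced by its deviation from one. By
    Parseval on the block, a single squared coefficient is at most the energy of that deviation over
    2^(k+1) points. *)
Lemma wavelet_le (R : rcfType) (n k a : nat) (f w : nat -> R) (c d m : R) :
  (w = wvec1 R k a) \/ (w = wvec2 R k a) -> (a + 2 ^ k.+1 <= n)%N -> 0 <= m ->
  (forall i, (i < 2 ^ k.+1)%N -> `|f (a + i)%N - (c + d * (a + i)%:R)| <= m) ->
  `|ip n w f| <= sqrt2 R ^+ k.+1 * m.
Proof.
move=> wE an m0 Hf.
have a1 : (a + 2 ^ k <= n)%N by rewrite expnS in an; lia.
have a2 : (a + 2 ^ k + 2 ^ k <= n)%N by rewrite expnS in an; lia.
have w0 : ip n w (fun x => c + d * x%:R) = 0.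
  have [P1 PX Q1 QX] := pqvec_moments R a1;
    have [P1' PX' Q1' QX'] := pqvec_moments R a2.
  set i := (sqrt2 R)^-1; pose co := alpert_cos R k; pose si := alpert_sin R k.
  rewrite ip_affine; case: wE => ->.
    have wE f' : ip n (wvec1 R k a) f' = 0 * ip n (qvec R k a) f' + 0 * ip n
      (qvec R k a) f' +
        i * ip n (qvec R k a) f' + (- i) * ip n (qvec R k (a + 2 ^ k)) f'.
      by apply: ip_comb4 => x; rewrite /wvec1 -/i; ring.
    by rewrite !wE Q1 QX Q1' QX'; ring.
  have wE f' : ip n (wvec2 R k a) f' = (co * i) * ip n (pvec R k a) f' +
       (- (co * i)) * ip n (pvec R k (a + 2 ^ k)) f' +
       (si * i) * ip n (qvec R k a) f' + (si * i) * ip n (qvec R k (a + 2 ^ k))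
         f'.
    by apply: ip_comb4 => x; rewrite /wvec2 -/i -/co -/si; ring.
  rewrite !wE P1 PX Q1 QX P1' PX' Q1' QX' natrD -sqrt2X_sqr.
  rewrite /i {i wE} /co /si {co si} /alpert_cos /alpert_sin.
  have := kappa_gt0 R k; have := sqrt2_sqr R; have := sqrt2_gt0 R.
  move: (sqrt2 R ^+ k) {P1 PX P1' PX' Q1 QX Q1' QX'} => h.
  move: (sqrt2 R) (kappa R k.+1) (kappa R k) => r K K' r0 r2 K0.
  have r0' := lt0r_neq0 r0; have K0' := lt0r_neq0 K0.
  transitivity (d * (h ^+ 3 * K' * (2 / r ^+ 2 - 1) / K)); first by field;
    rewrite r0' K0'.
  by rewrite r2; field.
pose g x := f x - (c + d * x%:R).
have -> : ip n w f = ip n w g by rewrite /g ipBr w0 subr0.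
have wB : (ip n w g) ^+ 2 <= (sqrt2 R ^+ k.+1 * m) ^+ 2.
  pose E := block_frame (fun=> 0 : R) k.+1 a.
  apply: (@le_trans _ _ (\sum_(e <- E) ip n e.1 g * ip n e.1 g)).
    have pos s : 0 <= \sum_(e <- s) ip n e.1 g * ip n e.1 g :> R.
      by apply: sumr_ge0 => e _; rewrite -expr2 sqr_ge0.
    rewrite /E /block_frame /= !big_cons /= -!expr2.
    set s := \sum_(e <- _) _.
    have s0 : 0 <= s by exact: pos.
    have q1 := sqr_ge0 (ip n (pvec R k.+1 a) g);
      have q2 := sqr_ge0 (ip n (qvec R k.+1 a) g).
    have q3 := sqr_ge0 (ip n (wvec1 R k a) g);
      have q4 := sqr_ge0 (ip n (wvec2 R k a) g).
    by rewrite -/(pvec R k.+1 a) -/(qvec R k.+1 a); case: wE => ->; lra.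
  rewrite (@frame_parseval _ _ _ (fun x => a
    <= x < a + 2 ^ k.+1)%N (@block_frame_kernel R _ k.+1 a)).
  rewrite [leLHS](@sum_interval R n a _ (fun x => g x * g x) an).
  rewrite exprMn sqrt2X_sqr -[X in X%:R]card_ord -sum1_card natr_sum mulr_suml.
  apply: ler_sum => i _; rewrite mul1r -expr2 -real_normK ?num_real//.
  by rewrite ler_sqr ?nnegrE//; exact: Hf.
have B0 : 0 <= sqrt2 R ^+ k.+1 * m by rewrite mulr_ge0// exprn_ge0// ltW//
  sqrt2_gt0.
by rewrite -ler_sqr ?nnegrE// real_normK ?num_real.
Qed.

(** * Wavelet coefficients of concave sequences *)

Definition slope (R : rcfType) (f : nat -> R) (x : nat) : R := f x.+1 - f x.

Definition concave_upto (R : rcfType) (n : nat) (f : nat -> R) : Prop :=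
  forall x, (x.+2 < n)%N -> slope f x.+1 <= slope f x.

(* Meaningful only for N >= 2, because of the truncated subtraction. *)
Definition slope_drop (R : rcfType) (f : nat -> R) (a N : nat) : R :=
  slope f a - slope f (a + N - 2).

Lemma slope_antitone (R : rcfType) (n : nat) (f : nat -> R) (x y : nat) :
  concave_upto n f -> (x <= y)%N -> (y.+1 < n)%N -> slope f y <= slope f x.
Proof.
move=> cf; elim: y => [|y ih] xy yn; first by move: xy;
  rewrite leqn0 => /eqP ->.
move: xy; rewrite leq_eqVlt => /orP[/eqP -> //|xy].
by apply: le_trans (cf _ yn) (ih _ _); lia.
Qed.

Lemma concave_chord_ge (R : rcfType) (n : nat) (f : nat -> R) (x m y : nat) :
  concave_upto n f -> (x + m <= y.+1)%N -> (y.+1 < n)%N ->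
  m%:R * slope f y <= f (x + m)%N - f x.
Proof.
move=> cf; elim: m => [|m ih] xm yn; first by rewrite mul0r addn0 subrr.
have h1 := ih ltac:(lia) yn.
have h2 : slope f y <= slope f (x + m)%N by apply: slope_antitone cf _ _; lia.
by rewrite -natr1 addnS; move: h2; rewrite {2}/slope; lra.
Qed.

Lemma concave_chord_le (R : rcfType) (n : nat) (f : nat -> R) (x m y : nat) :
  concave_upto n f -> (y <= x)%N -> (x + m < n)%N ->
  f (x + m)%N - f x <= m%:R * slope f y.
Proof.
move=> cf yx; elim: m => [|m ih] xm; first by rewrite mul0r addn0 subrr.
have h1 := ih ltac:(lia).
have h2 : slope f (x + m)%N <= slope f y by apply: slope_antitone cf _ _; lia.
by rewrite -natr1 addnS; move: h2; rewrite {1}/slope; lra.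
Qed.

(** Comparison with the tangent at the left end: every slope inside the block lies between its last
    slope and [slope f a]. *)
Lemma concave_affine_le (R : rcfType) (n : nat) (f : nat -> R) (a N i : nat) :
  concave_upto n f -> (a + N <= n)%N -> (i < N)%N -> (2 <= N)%N ->
  `|f (a + i)%N - ((f a - slope f a * a%:R) + slope f a * (a + i)%:R)| <=
  N%:R * slope_drop f a N.
Proof.
move=> cf an iN N2.
have d0 : 0 <= slope_drop f a N.
  by rewrite subr_ge0; apply: slope_antitone cf _ _; lia.
have h1 : f (a + i)%N - f a <= i%:R * slope f a.
  by apply: concave_chord_le cf _ _; lia.
have h2 : i%:R * slope f (a + N - 2)%N <= f (a + i)%N - f a.
  by apply: concave_chord_ge cf _ _; lia.
have h3 : i%:R * slope_drop f a N <= N%:R * slope_drop f a N.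
  by rewrite ler_wpM2r// ler_nat ltnW.
move: h3 d0; rewrite /slope_drop natrD => h3 d0.
by rewrite ler_norml; apply/andP; split; lra.
Qed.

(** The l1 bound. A coefficient is controlled by the slope drop of its own block, and the drops of
    the disjoint blocks of one scale add up to at most the drop of the whole block. *)
Lemma wavelets_sum_le (R : rcfType) (tau : nat -> R) (n k a : nat)
    (f : nat -> R) :
  (forall s, 0 <= tau s) -> concave_upto n f -> (a + 2 ^ k <= n)%N ->
  \sum_(e <- wavelets tau k a) e.2 * `|ip n e.1 f| <=
  (\sum_(s < k) 2 * tau s * sqrt2 R ^+ s.+1 * (2 ^ s.+1)%:R) *
  slope_drop f a (2 ^ k).
Proof.
move=> t0 cf; elim: k a => [|k ih] a an;
  first by rewrite big_nil big_ord0 mul0r.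
have a1 : (a + 2 ^ k <= n)%N by rewrite expnS in an; lia.
have a2 : (a + 2 ^ k + 2 ^ k <= n)%N by rewrite expnS in an; lia.
have h1 := ih a a1; have h2 := ih _ a2.
rewrite /= !big_cons big_cat big_ord_recr /=.
set c := \sum_(s < k) _ in h1 h2 *.
have c0 : 0 <= c.
  by apply: sumr_ge0 => s _; rewrite !mulr_ge0// exprn_ge0// ltW// sqrt2_gt0.
set D := slope_drop f a (2 ^ k.+1).
have N2 : (2 <= 2 ^ k.+1)%N by rewrite expnS; have := expn_gt0 2 k; lia.
have D0 : 0 <= D by rewrite subr_ge0; apply: slope_antitone cf _ _; lia.
have W w : w = wvec1 R k a \/ w = wvec2 R k a ->
    tau k * `|ip n w f| <= tau k * (sqrt2 R ^+ k.+1 * ((2 ^ k.+1)%:R * D)).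
  move=> wE; rewrite ler_wpM2l//.
  apply: (wavelet_le (c := f a - slope f a * a%:R) (d := slope f a) wE an).
    by rewrite mulr_ge0.
  by move=> i iN; apply: concave_affine_le cf _ iN N2.
have w1 := W _ (or_introl erefl); have w2 := W _ (or_intror erefl).
have h3 : c * slope_drop f a (2 ^ k) + c * slope_drop f (a + 2 ^ k) (2 ^ k)
  <= c * D.
  (* For k = 0 the halves have length 1, where [slope_drop] has no meaning, but then c = 0.
     Otherwise the slope ranges of the halves are consecutive. *)
  clear W w1 w2; rewrite -mulrDr; case: k {ih} @c c0 {h1 h2} @D D0 N2 an a1 a2
    => [|k] c c0 D D0 N2 an a1 a2.
    by rewrite /c big_ord0 !mul0r.
  apply: ler_wpM2l => //; rewrite /slope_drop /D /slope_drop.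
  have N2' : (2 <= 2 ^ k.+1)%N by rewrite expnS; have := expn_gt0 2 k; lia.
  have : slope f (a + 2 ^ k.+1)%N <= slope f (a + 2 ^ k.+1 - 2)%N.
    by apply: slope_antitone cf _ _; lia.
  rewrite (_ : a + 2 ^ k.+2 - 2 = a + 2 ^ k.+1 + 2 ^ k.+1 - 2)%N; first lra.
  by rewrite [(2 ^ k.+2)%N]expnS; lia.
rewrite mulrDl.
have -> : 2 * tau k * sqrt2 R ^+ k.+1 * (2 ^ k.+1)%:R * D =
  tau k * (sqrt2 R ^+ k.+1 * ((2 ^ k.+1)%:R * D)) + tau k * (sqrt2 R ^+ k.+1 *
    ((2 ^ k.+1)%:R * D)) by ring.
lra.
Qed.

Lemma sum_norm_le (R : rcfType) (k : nat) (u : nat -> R) (t : R) : 0 <= t ->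
  \sum_(i < 2 ^ k) u i ^+ 2 <= t ^+ 2 ->
  \sum_(i < 2 ^ k) `|u i| <= sqrt2 R ^+ k * t.
Proof.
move=> t0 ut; set r := (2 ^ k)%N in ut *; set h := sqrt2 R ^+ k.
have h0 : 0 < h by rewrite exprn_gt0// sqrt2_gt0.
have hr : h ^+ 2 = r%:R by rewrite sqrt2X_sqr.
pose S := \sum_(i < r) `|u i|; pose m := S / r%:R.
have r0 : 0 < (r%:R : R) by rewrite ltr0n expn_gt0.
have S0 : 0 <= S by exact: sumr_ge0.
(* Cauchy-Schwarz, from the nonnegativity of the variance of the absolute values. *)
have : 0 <= \sum_(i < r) (`|u i| - m) ^+ 2 by apply: sumr_ge0 => i _;
  exact: sqr_ge0.
have -> : \sum_(i < r) (`|u i| - m) ^+ 2 = \sum_(i < r) u i ^+ 2 - 2 * m * S +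
  r%:R * m ^+ 2.
  transitivity (\sum_(i < r) (u i ^+ 2 - 2 * m * `|u i| + m ^+ 2)).
    by apply: eq_bigr => i _; rewrite -(real_normK (num_real (u i))); ring.
  by rewrite big_split /= sumrB -mulr_sumr sumr_const card_ord -[_ *+
    r]mulr_natl.
have mS : r%:R * m = S by rewrite /m mulrC divfK// gt_eqF.
move=> h1; have ht : 0 <= h * t by rewrite mulr_ge0// ltW.
rewrite -ler_sqr ?nnegrE// -/S exprMn hr -mS exprMn.
have h2 : r%:R * m ^+ 2 <= t ^+ 2 by rewrite -mS in h1; lra.
by rewrite expr2 -mulrA ler_wpM2l// ltW.
Qed.

Lemma sum_sqr_shift_le (R : rcfType) (n c r : nat) (u : nat -> R) :
  (c + r <= n)%N -> \sum_(i < r) u (c + i)%N ^+ 2 <= \sum_(x < n) u x ^+ 2.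
Proof.
move=> cr; rewrite -(@sum_interval R n c r (fun x => u x ^+ 2) cr).
rewrite [leRHS](bigID (fun x : 'I_n => (c <= x < c + r)%N))/= lerDl.
by apply: sumr_ge0 => i _; exact: sqr_ge0.
Qed.

(* Average the chord slopes of f over the 2^k.+1 points on either side of the
   block: there f is bounded by V up to an l2-small perturbation. *)
Lemma slope_drop_le (R : rcfType) (n k a : nat) (f g : nat -> R) (V t : R) :
  concave_upto n f -> 0 <= t ->
  (2 ^ k.+1 <= a.+1)%N -> (a + 2 ^ k.+1 + 2 ^ k.+1 <= n.+1)%N ->
  (forall x, (x < n)%N -> `|g x| <= V) ->
  \sum_(x < n) (f x - g x) ^+ 2 <= t ^+ 2 ->
  (2 ^ k)%:R * ((2 ^ k)%:R * slope_drop f a (2 ^ k.+1)) <=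
  4 * (2 ^ k)%:R * V + 4 * sqrt2 R ^+ k * t.
Proof.
move=> cf t0; rewrite expnS mul2n -addnn; set r := (2 ^ k)%N => ar an gV ut.
have r0 : (0 < r)%N by rewrite expn_gt0.
(* Two windows of 2r points, one ending at a, the other starting at the last point b of the block.
   Sharing these end points explains the successors in the two hypotheses on a. *)
pose c := (a.+1 - (r + r))%N; pose b := (a + (r + r)).-1.
pose u x := f x - g x.
have S1 x : (x + r <= n)%N -> \sum_(i < r) `|u (x + i)%N| <= sqrt2 R ^+ k * t.
  move=> xn; apply: (@sum_norm_le R k (fun i => u (x + i)%N)) => //.
  by apply: le_trans ut; exact: (@sum_sqr_shift_le R n x r u).
have s1 := S1 c ltac:(lia); have s2 := S1 (c + r)%N ltac:(lia).
have s3 := S1 b ltac:(lia); have s4 := S1 (b + r)%N ltac:(lia).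
have fu x : (x < n)%N -> f x <= V + `|u x| /\ - f x <= V + `|u x|.
  move=> xn; have := gV x xn; have := ler_norm (u x); have := ler_norm (- u x).
  rewrite normrN ler_norml /u => h1 h2 /andP[h3 h4]; split; lra.
have -> : r%:R * (r%:R * slope_drop f a (r + r)) = \sum_(i < r) (r%:R *
  slope_drop f a (r + r)).
  by rewrite sumr_const card_ord mulr_natl.
apply: (@le_trans _ _ (\sum_(i < r) (4 * V + `|u (c + i)%N| + `|u (c + r +
  i)%N| +
   `|u (b + i)%N| + `|u (b + r + i)%N|))).
  (* The chord of length r from c + i has slope at least [slope f a], the one from b + i at most the
     last slope of the block. Their four end values are bounded by V plus the perturbation. *)
  apply: ler_sum => i _.
  have [i1 i2 i3] : [/\ (c + i + r <= a.+1)%N, (a + (r + r) - 2 <= b + i)%N &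
      (b + i + r < n)%N].
    by move: (ltn_ord i); rewrite /c /b; clear -ar an r0; split; lia.
  have [j1 j2 j3] : [/\ (a.+1 < n)%N, (c + r + i < n)%N & (b + i < n)%N].
    by move: (ltn_ord i); rewrite /c /b; clear -ar an r0; split; lia.
  have h1 := concave_chord_ge cf i1 j1.
  have h2 := concave_chord_le cf i2 i3.
  have ci : (c + i < n)%N by clear -j2; lia.
  rewrite addnAC in h1; rewrite [(b + i + r)%N]addnAC in h2 i3.
  move: h1 h2 (fu _ ci) (fu _ j2) (fu _ j3) (fu _ i3) => h1 h2 [f1 f2] [f3 f4]
    [f5 f6] [f7 f8].
  move: h1 h2 f2 f3 f5 f8; clear.
  rewrite /slope_drop; lra.
rewrite !big_split /= sumr_const card_ord -[(4 * V) *+ r]mulr_natl; lra.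
Qed.

(** * Weights, counts and bias within one block *)

Lemma sum_shifted_geometric_deriv (R : realFieldType) (J k : nat) :
  \sum_(l < k) (l - J)%:R * (2^-1 : R) ^+ (l - J) =
  2 - 2 * (k - J).+1%:R * 2^-1 ^+ (k - J).
Proof.
elim: k => [|k ih]; first by rewrite big_ord0 sub0n expr0; ring.
rewrite big_ord_recr /= ih; have [Jk|kJ] := leqP J k.
  by rewrite subSn// -!natr1 exprS; field.
have -> : (k.+1 - J = 0)%N by lia.
have -> : (k - J = 0)%N by lia.
by rewrite mul0r addr0.
Qed.

Lemma sum_shifted_quarter (R : realFieldType) (J k : nat) :
  \sum_(l < k) (2 ^ l)%:R * (4^-1 : R) ^+ (l - J) <= 3 * (2 ^ J)%:R.
Proof.
(* A bound fit for induction: geometric growth up to level J, geometric decay beyond it. *)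
have H : \sum_(l < k) (2 ^ l)%:R * (4^-1 : R) ^+ (l - J) <=
   (2 ^ minn k J)%:R + (2 ^ J)%:R * (2 - 2 * 2^-1 ^+ (k - J)).
  elim: k => [|k ih].
    by rewrite big_ord0 min0n sub0n expr0 mulr1 subrr mulr0 addr0.
  rewrite big_ord_recr /=; have [Jk|kJ] := leqP J k.
    rewrite subSn// (minn_idPr (leqW Jk)).
    rewrite (minn_idPr Jk) in ih.
    have -> : (2 ^ k)%:R * 4^-1 ^+ (k - J) = (2 ^ J)%:R * 2^-1 ^+ (k - J) :> R.
      rewrite -{1}(subnKC Jk) expnD natrM -mulrA; congr (_ * _).
      rewrite natrX -exprMn; congr (_ ^+ _); by field.
    by rewrite exprS; move: (_ ^+ _) ih => q ih; lra.
  have e1 : (k.+1 - J = 0)%N by lia.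
  have e2 : (k - J = 0)%N by lia.
  rewrite e2 in ih *; rewrite e1 (minn_idPl kJ).
  rewrite (minn_idPl (ltnW kJ)) in ih.
  by rewrite expr0 in ih *; rewrite expnS natrM; lra.
apply: le_trans H _.
have h1 : (2 ^ minn k J)%:R <= (2 ^ J)%:R :> R.
  by rewrite ler_nat; apply: leq_pexp2l => //; exact: geq_minr.
have h2 : 0 <= (2 ^ J)%:R * (2^-1 : R) ^+ (k - J)
  by rewrite mulr_ge0// exprn_ge0 ?invr_ge0.
lra.
Qed.

(* In a block of length 2^k, wavelets at scale s sit at level k.-1 - s, counted
   from the coarsest; the truncated subtraction gives threshold 0 up to level
   J. *)
Definition wavelet_threshold (R : rcfType) (k J s : nat) : R :=
  4 * (k.-1 - s - J)%:R.

(** With m = l - J levels beyond J, the weights decay like m 2^(-3m/2), here relaxed to m 2^(-m),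
    whose sum is at most 2. So level J fixes the order of the sum. *)
Lemma wavelet_weights_le (R : rcfType) (k J : nat) :
  (\sum_(s < k) 2 * wavelet_threshold R k J s * sqrt2 R ^+ s.+1 * (2 ^ s.+1)%:R)
    * (sqrt2 R ^+ J) ^+ 3 <= 16 * (sqrt2 R ^+ k) ^+ 3.
Proof.
have r0 := sqrt2_gt0 R; have r2 := sqrt2_sqr R.
have r1 : 1 <= sqrt2 R.
  by rewrite -(@ler_sqr R) ?nnegrE ?(ltW r0)// r2 expr1n ler1n.
apply: (@le_trans _ _ (\sum_(l < k) (8 * (sqrt2 R ^+ k) ^+ 3) * ((l - J)%:R *
  2^-1 ^+ (l - J)))).
  rewrite mulr_suml (reindex_inj rev_ord_inj) /=; apply: ler_sum => l _.
  have lk := ltn_ord l.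
  rewrite /wavelet_threshold (_ : k.-1 - (k - l.+1) - J = l - J)%N; last by lia.
  rewrite (_ : (k - l.+1).+1 = k - l)%N; last by lia.
  have [Jl|lJ] := leqP J l; last first.
    by rewrite (_ : l - J = 0)%N ?(mulr0, mul0r)//; lia.
  rewrite -sqrt2X_sqr.
  have -> : sqrt2 R ^+ k = sqrt2 R ^+ (k - l) * sqrt2 R ^+ J * sqrt2 R ^+ (l -
    J).
    by rewrite -!exprD; congr (_ ^+ _); lia.
  have h : 1 <= (sqrt2 R ^+ (l - J)) ^+ 3 * 2^-1 ^+ (l - J).
    rewrite -exprM mulnC exprM -exprMn exprn_ege1// exprS r2.
    by rewrite -mulrA divff ?pnatr_eq0// mulr1.
  move: (sqrt2 R ^+ (k - l)) (sqrt2 R ^+ J) (sqrt2 R ^+ (l - J)) (2^-1 ^+ (l -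
    J)) h
    (exprn_ge0 (k - l) (ltW r0)) (exprn_ge0 J (ltW r0)) => x y z w h x0 y0.
  have -> : 2 * (4 * (l - J)%:R) * x * x ^+ 2 * y ^+ 3 = (8 * (l - J)%:R * (x *
    y) ^+ 3) * 1 by ring.
  have -> : 8 * (x * y * z) ^+ 3 * ((l - J)%:R * w) =
    (8 * (l - J)%:R * (x * y) ^+ 3) * (z ^+ 3 * w) by ring.
  by apply: ler_wpM2l h; rewrite !mulr_ge0 ?exprn_ge0 ?mulr_ge0.
rewrite -mulr_sumr sum_shifted_geometric_deriv.
have h1 : 0 <= (sqrt2 R ^+ k) ^+ 3 * (2 * (k - J).+1%:R * 2^-1 ^+ (k - J)).
  by rewrite !mulr_ge0 ?exprn_ge0 ?invr_ge0 ?(ltW r0).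
by rewrite mulrBr -!mulrA; rewrite -mulrA in h1; lra.
Qed.

Lemma wavelets_count (R : rcfType) (tau : nat -> R) (phi : R -> R) (k a : nat) :
  \sum_(e <- wavelets tau k a) phi e.2 =
  \sum_(s < k) 2 * (2 ^ (k.-1 - s))%:R * phi (tau s).
Proof.
elim: k a => [|k ih] a; first by rewrite big_nil big_ord0.
rewrite /= !big_cons big_cat /= !ih big_ord_recr /= subnn expn0 -big_split /=.
rewrite (eq_bigr (fun s : 'I_k => 2 * (2 ^ (k - s))%:R * phi (tau s)));
  last first.
  move=> s _; have sk := ltn_ord s.
  by rewrite (_ : k - s = (k.-1 - s).+1)%N; [rewrite expnS natrM; ring|lia].
by ring.
Qed.

(** Up to level J every wavelet counts for at most 1; beyond it the factor 4^(-i) beats the doubling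
    of the number of wavelets. Later phi is the Gaussian weight exp (- 2/17 tau^2). *)
Lemma block_count_le (R : rcfType) (phi : R -> R) (k J a : nat) :
  (forall i, phi (4 * i%:R) <= 4^-1 ^+ i) ->
  \sum_(e <- block_frame (wavelet_threshold R k J) k a) phi e.2 <=
  8 * (2 ^ J)%:R.
Proof.
move=> Hphi; rewrite /block_frame !big_cons /= wavelets_count.
have p0 : phi 0 <= 1 by have := Hphi 0%N; rewrite mulr0 expr0.
have J1 : 1 <= (2 ^ J)%:R :> R by rewrite ler1n expn_gt0.
apply: (@le_trans _ _ (1 + (1 + 2 * (3 * (2 ^ J)%:R)))); last by lra.
apply: lerD => //; apply: lerD => //.
apply: le_trans (ler_wpM2l _ (sum_shifted_quarter R J k)); last by [].
rewrite mulr_sumr (reindex_inj rev_ord_inj) /=; apply: ler_sum => l _.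
have lk := ltn_ord l.
rewrite /wavelet_threshold (_ : k.-1 - (k - l.+1) = l)%N; last by lia.
by rewrite -mulrA ler_wpM2l// ler_wpM2l.
Qed.

(** The difference f - g need not be concave, so the l1 bound is applied to f and to g separately.
    The slope drop of g is controlled by V, that of f by V and t. *)
Lemma block_bias_le (R : rcfType) (n k J a : nat) (f g : nat -> R) (V t : R) :
  concave_upto n f -> concave_upto n g -> 0 <= V -> 0 <= t ->
  (2 ^ k <= a.+1)%N -> (a + 2 ^ k + 2 ^ k <= n.+1)%N ->
  (forall x, (x < n)%N -> `|g x| <= V) ->
  \sum_(x < n) (f x - g x) ^+ 2 <= t ^+ 2 ->
  \sum_(e <- block_frame (wavelet_threshold R k J) k a)
     e.2 * `|ip n e.1 (fun x => f x - g x)| <=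
  16 * 16 * (sqrt2 R ^+ k * V + t) / (sqrt2 R ^+ J) ^+ 3.
Proof.
move=> cf cg V0 t0 ak an gV ut.
have r0 := sqrt2_gt0 R; have r2 := sqrt2_sqr R.
have J0 : 0 < (sqrt2 R ^+ J) ^+ 3 by rewrite !exprn_gt0.
rewrite /block_frame !big_cons /= !mul0r !add0r.
case: k ak an => [|k] ak an.
  have kV0 : 0 <= sqrt2 R ^+ 0 * V by rewrite expr0 mul1r.
  rewrite big_nil; apply: divr_ge0 (ltW J0).
  by apply: mulr_ge0; [rewrite mulr_ge0|exact: addr_ge0].
have tau0 s : 0 <= wavelet_threshold R k.+1 J s by rewrite mulr_ge0.
have k2 : (2 <= 2 ^ k.+1)%N by rewrite expnS; have := expn_gt0 2 k; lia.
have an' : (a + 2 ^ k.+1 <= n)%N by lia.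
have Wf := wavelets_sum_le tau0 cf an'; have Wg := wavelets_sum_le tau0 cg an'.
apply: (@le_trans _ _ (\sum_(e <- wavelets (wavelet_threshold R k.+1 J) k.+1 a)
  e.2 * `|ip n e.1 f| +
   \sum_(e <- wavelets (wavelet_threshold R k.+1 J) k.+1 a) e.2 * `|ip n e.1
     g|)).
  have : all (fun e => 0 <= e.2) (wavelets (wavelet_threshold R k.+1 J) k.+1 a).
    move: (wavelet_threshold R k.+1 J) tau0 => ta ta0.
    by elim: (k.+1) (a) => //= m ih b; rewrite !ta0 /= all_cat !ih.
  elim: (wavelets _ _ _) => [|e E ih] /=; first by rewrite !big_nil addr0.
  move=> /andP[e0 /ih hE]; rewrite !big_cons.
  have : e.2 * `|ip n e.1 (fun x => f x - g x)|
    <= e.2 * (`|ip n e.1 f| + `|ip n e.1 g|).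
    by rewrite ler_wpM2l// ipBr ler_normB.
  by rewrite mulrDr; move: hE; lra.
apply: le_trans (lerD Wf Wg) _; rewrite -mulrDr.
have Df := slope_drop_le cf t0 ak an gV ut.
(* Here g is compared with itself, so the perturbation is 0. *)
have Dg : (2 ^ k)%:R * ((2 ^ k)%:R * slope_drop g a (2 ^ k.+1))
  <= 4 * (2 ^ k)%:R * V.
  have := @slope_drop_le R n k a g g V 0 cg (lexx _) ak an gV.
  rewrite mulr0 addr0; apply.
  by rewrite big1 ?expr0n// => i _; rewrite subrr expr0n.
have := wavelet_weights_le R k.+1 J.
set A := \sum_(s < _) _; set D := slope_drop f _ _ + _ => hA.
have A0 : 0 <= A by apply: sumr_ge0 => s _; rewrite !mulr_ge0// exprn_ge0// ltW.
rewrite -sqrt2X_sqr in Df Dg.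
rewrite (exprS (sqrt2 R) k) in hA *.
have h0 : 0 < sqrt2 R ^+ k by rewrite exprn_gt0.
move: (sqrt2 R ^+ k) h0 ((sqrt2 R ^+ J) ^+ 3) J0 hA Df Dg => h h0 j J0 hA Df Dg.
rewrite ler_pdivlMr//.
have hD : h ^+ 3 * D <= 8 * h * V + 4 * t.
  rewrite -(ler_pM2l h0).
  have -> : h * (h ^+ 3 * D) = h ^+ 2 * (h ^+ 2 * slope_drop f a (2 ^ k.+1)) +
      h ^+ 2 * (h ^+ 2 * slope_drop g a (2 ^ k.+1)) by rewrite /D; ring.
  by move: Df Dg; lra.
have aN : (a <= a + 2 ^ k.+1 - 2)%N by clear -k2; lia.
have Nn : ((a + 2 ^ k.+1 - 2).+1 < n)%N by clear -k2 an'; lia.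
have D0 : 0 <= D by rewrite addr_ge0// subr_ge0; exact: slope_antitone aN Nn.
have r2' : sqrt2 R <= 2.
  by rewrite -(@ler_sqr R) ?nnegrE ?(ltW r0)// r2 -natrX ler_nat.
have -> : A * D * j = A * j * D by ring.
apply: le_trans (ler_wpM2r D0 hA) _.
have -> : 16 * (sqrt2 R * h) ^+ 3 * D = 16 * (sqrt2 R ^+ 2 * sqrt2 R) * (h ^+ 3
  * D) by ring.
rewrite r2.
have p1 : 0 <= 16 * (2 * sqrt2 R) by rewrite !mulr_ge0// ltW.
apply: le_trans (ler_wpM2l p1 hD) _.
have : sqrt2 R * t <= 2 * t by rewrite ler_wpM2r.
by rewrite !mulrDr; lra.
Qed.

(** * Assembling the blocks *)

Lemma sum_geometric_le (R : realFieldType) (r : R) (n : nat) :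
  0 <= r -> r < 1 -> \sum_(i < n) r ^+ i <= (1 - r)^-1.
Proof.
move=> r0 r1; have r1' : 0 < 1 - r by rewrite subr_gt0.
rewrite -[_^-1]mul1r ler_pdivlMr// mulrC -opprB mulNr -subrX1 opprB.
by rewrite lerBlDr lerDl exprn_ge0.
Qed.

Definition in_block (b : nat * nat) (x : nat) : bool :=
  (b.2 <= x < b.2 + 2 ^ b.1)%N.

(** The binary expansion of r, largest block first: each scale occurs at most once, which gives the
    last claim. Summing indicators to an indicator encodes a partition. *)
Lemma binary_blocks (R : numDomainType) (K r a : nat) : (r < 2 ^ K.+1)%N ->
  exists s : seq (nat * nat),
    [/\ forall x, (\sum_(b <- s) in_block b x = (a <= x < a + r))%N,
        all (fun b => [&& b.1 <= K, a <= b.2 & b.2 + 2 ^ b.1 <= a + r])%N s &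
        forall G : nat -> R, (forall k, 0 <= G k) ->
          \sum_(b <- s) G b.1 <= \sum_(k < K.+1) G k].
Proof.
elim: K r a => [|K ih] r a rK.
  have [r0|r0] := posnP r.
    exists [::]; split => // [x|G G0]; first by rewrite big_nil r0; lia.
    by rewrite big_nil big_ord_recr big_ord0 /= add0r.
  exists [:: (0, a)]%N; split => [x||G G0];
    rewrite ?big_seq1 /in_block /= ?expn0.
  - by congr (nat_of_bool _); lia.
  - by lia.
  - by rewrite big_ord_recr big_ord0 /= add0r.
have [rK'|Kr] := ltnP r (2 ^ K.+1).
  have [s [s1 s2 s3]] := ih r a rK'; exists s; split => // [|G G0].
    by apply: sub_all s2 => b /and3P[b1 b2 b3]; apply/and3P; split => //;
      exact: leqW.
  by rewrite big_ord_recr /=; apply: le_trans (s3 G G0) _; rewrite lerDl.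
have [|s [s1 s2 s3]] := ih (r - 2 ^ K.+1)%N (a + 2 ^ K.+1)%N.
  by rewrite [(2 ^ K.+2)%N]expnS in rK; lia.
exists ((K.+1, a) :: s); split => [x||G G0].
- rewrite big_cons s1 /in_block /=.
  by rewrite -addnA subnKC//; have := expn_gt0 2 K.+1; lia.
- rewrite /= leqnn leqnn leq_add2l Kr /=.
  apply: sub_all s2 => b /and3P[b1 b2 b3]; apply/and3P; split;
    first exact: leqW.
    by apply: leq_trans b2; exact: leq_addr.
  by rewrite -addnA subnKC// in b3.
- by rewrite big_cons [leRHS]big_ord_recr /= [leRHS]addrC lerD2l; exact: s3.
Qed.

(* A Whitney-type decomposition: every block of length N keeps a distance at
   least N - 1 from both ends of [0, n). *)
Lemma whitney_blocks (R : numDomainType) (n : nat) : (0 < n)%N ->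
  exists (K : nat) (s : seq (nat * nat)),
    [/\ (2 ^ K <= n)%N,
        forall x, (\sum_(b <- s) in_block b x = (x < n))%N,
        all (fun b => (2 ^ b.1 <= b.2.+1) && (b.2 + 2 ^ b.1 + 2 ^ b.1
          <= n.+1))%N s &
        forall G : nat -> R, (forall k, 0 <= G k) ->
          \sum_(b <- s) G b.1 <= 3 * \sum_(k < K.+1) G k].
Proof.
move=> n0; pose K := trunc_log 2 (n./2).+1.
have K1 : (2 ^ K <= n./2.+1)%N by apply: trunc_logP.
have K2 : (n./2.+1 < 2 ^ K.+1)%N by apply: trunc_log_ltn.
have Kp := expn_gt0 2 K; rewrite expnS in K2.
pose A := (2 ^ K - 1)%N.
have [|mid [m1 m2 m3]] := @binary_blocks R K (n - 2 * A)%N A.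
  by rewrite expnS /A; lia.
(* The blocks [2^i - 1, 2^(i+1) - 1) fill [0, A), their mirror images fill [n - A, n), and the
   middle, shorter than 2^(K+1), is cut in binary. Each scale occurs at most three times, hence the
   factor 3. *)
pose left := [seq (i, 2 ^ i - 1)%N | i <- iota 0 K].
pose right := [seq (i, n - (2 ^ i.+1 - 1))%N | i <- iota 0 K].
have iotaP i : i \in iota 0 K -> (2 ^ i.+1 <= 2 ^ K)%N.
  by rewrite mem_iota add0n => /andP[_ iK]; rewrite leq_exp2l.
exists K, (left ++ mid ++ right); split => [|x||G G0].
- by lia.
- rewrite !big_cat /= m1.
  have -> : (\sum_(b <- left) in_block b x = (x < A))%N.
    rewrite big_map -[X in iota X _]/(0%N) -[K in iota _ K]subn0 -/(index_iota
      0 K) /A.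
    elim: (K) => [|k ih]; first by rewrite big_geq.
    by rewrite big_nat_recr//= ih /in_block /= expnS; have := expn_gt0 2 k; lia.
  have -> : (\sum_(b <- right) in_block b x = (n - A <= x < n))%N.
    rewrite big_map -[X in iota X _]/(0%N) -[K in iota _ K]subn0 -/(index_iota
      0 K).
    have : (2 ^ K - 1 <= n)%N by lia.
    rewrite /A; elim: (K) => [|k ih] kn; first by rewrite big_geq//; lia.
    rewrite big_nat_recr//= ih /in_block /=; last by rewrite expnS in kn; lia.
    by rewrite expnS in kn *; have := expn_gt0 2 k; lia.
  by rewrite /A; lia.
- rewrite !all_cat; apply/and3P; split.
  + apply/allP => b /mapP[i /iotaP iK ->] /=; rewrite expnS in iK.
    by have := expn_gt0 2 i; lia.
  + apply: sub_all m2 => b /and3P[b1 b2 b3].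
    have : (2 ^ b.1 <= 2 ^ K)%N by rewrite leq_exp2l.
    by move: b2 b3; rewrite /A; lia.
  + apply/allP => b /mapP[i /iotaP iK ->] /=; rewrite expnS in iK *.
    by have := expn_gt0 2 i; lia.
- rewrite !big_cat /= !big_map.
  have E : \sum_(i <- iota 0 K) G i <= \sum_(k < K.+1) G k.
    by rewrite big_ord_recr /= -(big_mkord xpredT) /index_iota subn0 lerDl.
  rewrite (_ : 3 = 1 + 1 + 1 :> R); last by ring.
  by rewrite !mulrDl mul1r -addrA; apply: lerD => //; apply: lerD => //;
    exact: m3.
Qed.

Lemma le_sum_all (R : numDomainType) (S : Type) (s : seq S) (p : pred S)
    (f g : S -> R) :
  all p s -> (forall b, p b -> f b <= g b) ->
  \sum_(b <- s) f b <= \sum_(b <- s) g b.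
Proof.
move=> ps fg; elim: s ps => [|b s ih] /=; first by rewrite !big_nil.
by move=> /andP[pb /ih h]; rewrite !big_cons lerD// fg.
Qed.

(** With q the tenth root of 2, sqrt 2 = q^5 and 2^(1/5) = q^2, so the whole trade-off becomes
    arithmetic on exponents of q. The count bounds the stochastic term, the weighted sum the bias,
    both of order M. *)
Lemma whitney_frame (R : rcfType) (q : R) : 1 < q -> q ^+ 10 = 2 ->
  exists2 C : R, 0 <= C &
  forall (n v : nat) (V : R), (0 < n)%N -> 0 <= V -> (2 ^ v)%:R <= V ^+ 2 ->
    V ^+ 2 <= (2 ^ v.+1)%:R ->
  exists (E : seq ((nat -> R) * R)) (M : R),
    [/\ 0 <= M /\ M ^+ 5 <= n%:R * V ^+ 2,
        all (fun e => 0 <= e.2) E,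
        forall x y, \sum_(e <- E) e.1 x * e.1 y = ((x == y) && (x < n)%N)%:R,
        forall phi : R -> R, (forall i, phi (4 * i%:R) <= 4^-1 ^+ i) ->
          \sum_(e <- E) phi e.2 <= C * M &
        forall (f g : nat -> R) (t : R),
          concave_upto n f -> concave_upto n g -> 0 <= t ->
          (forall x, (x < n)%N -> `|g x| <= V) ->
          \sum_(x < n) (f x - g x) ^+ 2 <= t ^+ 2 ->
          \sum_(e <- E) e.2 * `|ip n e.1 (fun x => f x - g x)| <= C * (M + t)].
Proof.
move=> q1 q10.
have q0 : 0 < q by exact: lt_trans q1.
have r2 : sqrt2 R = q ^+ 5.
  apply/eqP; rewrite -(@eqrXn2 _ 2)// ?(ltW (sqrt2_gt0 R)) ?exprn_ge0 ?(ltW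
    q0)//.
  by rewrite sqrt2_sqr -exprM q10.
pose p := q^-1; have p0 : 0 < p by rewrite invr_gt0.
have p1 : p < 1 by rewrite invf_lt1.
pose c := (1 - p)^-1; have c0 : 0 < c by rewrite invr_gt0 subr_gt0.
exists (48 * 64 * c); first by rewrite !mulr_ge0// ltW.
move=> n v V n0 V0 vV Vv.
have [K [s [Kn scov spos ssum]]] := whitney_blocks R n0.
(* The level balancing the count 2^J against the bias 2^(k/2) V 2^(-3J/2), as V^2 is about 2^v. Both
   are then about q^(2 (k + v)), a geometric sequence in k dominated by the top scale K, whence
   M. *)
pose J k := ((k + v) %/ 5)%N.
pose M := q ^+ (2 * (K + v)).
exists (flatten [seq block_frame (wavelet_threshold R b.1 (J b.1)) b.1 b.2 | b
  <- s]), M.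
have geo m : (0 < m)%N -> \sum_(k < K.+1) p ^+ (m * k) <= c.
  move=> m0; apply: le_trans (sum_geometric_le K.+1 (ltW p0) p1).
  apply: ler_sum => k _; apply: ler_wiXn2l; rewrite ?(ltW p0) ?(ltW p1)//.
  exact: leq_pmull.
have geoM : \sum_(k < K.+1) q ^+ (2 * (k + v)) <= c * M.
  apply: le_trans (ler_wpM2r _ (geo 2%N isT)); last by rewrite exprn_ge0// ltW.
  rewrite mulr_suml (reindex_inj rev_ord_inj) /=; apply: ler_sum => k _.
  have kK := ltn_ord k.
  rewrite /M /p exprVn mulrC ler_pdivlMr ?exprn_gt0// -exprD.
  rewrite (_ : (2 * (K.+1 - k.+1 + v) + 2 * k = 2 * (K + v))%N) ?lexx//.
  by clear -kK; lia.
have M0 : 0 <= M by rewrite exprn_ge0// ltW.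
split.
- split => //; rewrite /M -exprM (_ : 2 * (K + v) * 5 = 10 * (K + v))%N;
    last by clear; lia.
  by rewrite exprM q10 -natrX expnD natrM; apply: ler_pM => //; rewrite ler_nat.
- elim: s {scov spos ssum} => //= b s ih; rewrite all_cat ih andbT.
  have ta0 x : 0 <= wavelet_threshold R b.1 (J b.1) x by rewrite mulr_ge0.
  rewrite lexx /=; move: (wavelet_threshold _ _ _) ta0 => ta ta0.
  by elim: (b.1) (b.2) => //= m ih' a; rewrite !ta0 /= all_cat !ih'.
- move=> x y; rewrite big_flatten big_map /=.
  under eq_bigr do rewrite block_frame_kernel.
  rewrite -natr_sum; congr (_%:R); case: eqP => [->|_] /=; last by rewrite big1.
  exact: scov.
- move=> phi Hphi; rewrite big_flatten big_map /=.
  apply: (@le_trans _ _ (\sum_(b <- s) 8 * q ^+ (2 * (b.1 + v)))).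
    apply: ler_sum => b _; apply: le_trans (block_count_le _ _ _ Hphi) _.
    rewrite ler_wpM2l// natrX -q10 -exprM ler_eXn2l// /J.
    by move: (leq_trunc_div (b.1 + v) 5); clear; lia.
  have h0 k : 0 <= 8 * q ^+ (2 * (k + v)) by rewrite mulr_ge0// exprn_ge0// ltW.
  apply: le_trans (ssum (fun k => 8 * q ^+ (2 * (k + v))) h0) _.
  rewrite -mulr_sumr.
  have : 0 <= c * M by rewrite mulr_ge0// ltW.
  by move: geoM; clear; lra.
- move=> f g t cf cg t0 gV ut; rewrite big_flatten big_map /=.
  pose G k := 32 * 32 * (q ^+ (2 * (k + v)) + t * p ^+ (3 * k)).
  have G0 k : 0 <= G k.
    have h1 : 0 <= q ^+ (2 * (k + v)) by rewrite exprn_ge0// ltW.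
    have h2 : 0 <= t * p ^+ (3 * k) by rewrite mulr_ge0// exprn_ge0// ltW.
    by rewrite !mulr_ge0// addr_ge0.
  apply: (@le_trans _ _ (\sum_(b <- s) G b.1)).
    apply: (le_sum_all spos) => -[k a] /= /andP[ka an].
    apply: le_trans (block_bias_le (J k) cf cg V0 t0 ka an gV ut) _.
    rewrite r2 -!exprM.
    rewrite ler_pdivrMr ?exprn_gt0//.
    have V1 : V <= q ^+ (5 * v.+1).
      rewrite -(@ler_sqr R) ?nnegrE ?exprn_ge0 ?(ltW q0)// -exprM.
      by rewrite (_ : 5 * v.+1 * 2 = 10 * v.+1)%N;
        [rewrite exprM q10 -natrX|clear; lia].
    (* Rounding J down costs at most q^12 and rounding V up costs q^5; the factor q^20 = 4 covers
       both. *)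
    have J1 : (3 * (k + v) <= 5 * (J k * 3) + 12)%N.
      move: (divn_eq (k + v) 5) (ltn_pmod (k + v) (isT : (0 < 5)%N)).
      by rewrite /J; clear; lia.
    have q20 : q ^+ 20 = 4 by rewrite (exprM q 10 2) q10 -natrX.
    have e1 : q ^+ (5 * k) * V <= 4 * q ^+ (2 * (k + v)) * q ^+ (5 * (J k * 3)).
      apply: le_trans (ler_wpM2l (exprn_ge0 _ (ltW q0)) V1) _.
      by rewrite -q20 -!exprD ler_eXn2l//; clear -J1; lia.
    have e2 : t <= 4 * (t * p ^+ (3 * k)) * q ^+ (5 * (J k * 3)).
      have -> : 4 * (t * p ^+ (3 * k)) * q ^+ (5 * (J k * 3)) =
        t * (q ^+ 20 * q ^+ (5 * (J k * 3)) / q ^+ (3 * k))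
          by rewrite q20 /p exprVn; ring.
      rewrite -[leLHS]mulr1 ler_wpM2l// ler_pdivlMr ?exprn_gt0// mul1r -exprD.
      by rewrite ler_eXn2l//; clear -J1; lia.
    rewrite /G; move: e1 e2; clear; lra.
  apply: le_trans (ssum G G0) _; rewrite /G -mulr_sumr big_split /= -mulr_sumr.
  have := ler_wpM2l t0 (geo 3%N isT); move: geoM; clear; lra.
Qed.

(** * Exponential moments of Gaussian vectors *)

(** From indicators to simple functions by linearity, then to h by monotone convergence. Two uses:
    m2 the law of a coordinate and G the product of the other factors (independence), or G a density
    and X the identity (change of measure). *)
Lemma ge0_integral_factor d d' (T : measurableType d) (S : measurableType d')
    (R : realType) (m1 : {measure set T -> \bar R})
    (m2 : {measure set S -> \bar R}) (X : T -> S) (G : T -> R) (h : S -> R)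
    (c : \bar R) :
  measurable_fun setT X -> measurable_fun setT G -> (forall w, 0 <= G w) ->
  measurable_fun setT h -> (forall x, 0 <= h x) -> c \is a fin_num ->
  (forall A, measurable A ->
    (\int[m1]_w (G w * \1_A (X w))%:E = c * m2 A)%E) ->
  (\int[m1]_w (G w * h (X w))%:E = c * \int[m2]_x (h x)%:E)%E.
Proof.
move=> mX mG G0 mh h0 cfin HA.
have mh' : measurable_fun setT (EFin \o h) by exact/measurable_EFinP.
pose f := nnsfun_approx measurableT mh'.
have f0 k x : (0 <= (f k x)%:E)%E by rewrite lee_fin.
have ndf x a b : (a <= b)%N -> f a x <= f b x.
  by move=> ab; exact/lefP/nd_nnsfun_approx.
have fh x : (EFin \o f ^~ x) @ \oo --> (h x)%:E.
  by apply: cvg_nnsfun_approx => // y _; rewrite lee_fin.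
have mf k : measurable_fun setT (fun x => (f k x)%:E).
  exact/measurable_EFinP.
have mGf k : measurable_fun setT (fun w => (G w * f k (X w))%:E).
  by apply/measurable_EFinP; apply: measurable_funM => //;
    exact: measurableT_comp.
have simple k : (\int[m1]_w (G w * f k (X w))%:E = c * \int[m2]_x (f k x)%:E)%E.
  have fE x : (f k x)%:E = (\sum_(y \in range (f k)) (y * \1_(f k @^-1` [set
    y]) x)%:E)%E.
    by rewrite fimfunE -fsumEFin.
  have mI y : measurable (f k @^-1` [set y]) by [].
  have mIX y : measurable_fun setT (fun w => \1_(f k @^-1` [set y]) (X w) : R).
    by apply: measurableT_comp.
  have y0 y w : (0 <= (y * \1_(f k @^-1` [set y]) w)%:E)%E by apply:
    nnfun_muleindic_ge0.
  under eq_integral do rewrite EFinM fE ge0_mule_fsumr//.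
  under [in RHS]eq_integral do rewrite fE.
  rewrite ge0_integral_fsum//; last 2 first.
  - move=> y; under eq_fun do rewrite -EFinM.
    by apply/measurable_EFinP; apply: measurable_funM => //;
      apply: measurable_funM.
  - by move=> y w _; rewrite mule_ge0// lee_fin.
  rewrite ge0_integral_fsum//; last first.
    by move=> y; apply/measurable_EFinP; apply: measurable_funM.
  rewrite ge0_mule_fsumr; last by move=> y; exact: integral_ge0.
  apply: eq_fsbigr => y; rewrite inE => -[x _ <-].
  under eq_integral do rewrite -EFinM mulrCA EFinM.
  rewrite ge0_integralZl_EFin//; last 2 first.
  - by move=> w _; rewrite lee_fin mulr_ge0.
  - by apply/measurable_EFinP; apply: measurable_funM.
  rewrite HA//.
  under [in RHS]eq_integral do rewrite EFinM.
  rewrite ge0_integralZl_EFin//; first by rewrite integral_indic// setIT muleCA.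
  by apply/measurable_EFinP.
have L1 : (\int[m1]_w (G w * f k (X w))%:E)%E @[k --> \oo]
    --> (\int[m1]_w (G w * h (X w))%:E)%E.
  rewrite (_ : (\int[m1]_w (G w * h (X w))%:E)%E =
      (\int[m1]_w limn (fun k => (G w * f k (X w))%:E))%E).
    apply: cvg_monotone_convergence => //.
    - by move=> k w _; rewrite lee_fin mulr_ge0.
    - by move=> w _ a b ab; rewrite lee_fin ler_wpM2l// ndf.
  apply: eq_integral => w _; apply/esym/cvg_lim => //.
  rewrite EFinM; under eq_fun do rewrite EFinM.
  by apply: cvgeZl => //; exact: fh.
have L2 : (\int[m2]_x (f k x)%:E)%E @[k --> \oo] --> (\int[m2]_x (h x)%:E)%E.
  rewrite (_ : (\int[m2]_x (h x)%:E)%E = (\int[m2]_x limn (fun k => (f k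
    x)%:E))%E).
    apply: cvg_monotone_convergence => //.
    by move=> x _ a b ab; rewrite lee_fin ndf.
  by apply: eq_integral => w _; apply/esym/cvg_lim => //; exact: fh.
rewrite -(cvg_lim _ L1)// -(cvg_lim _ L2)//.
under eq_fun do rewrite simple.
by apply/cvg_lim => //; apply: cvgeZl => //; rewrite (cvg_lim _ L2).
Qed.

(** Independence is the case of indicators; they are replaced by the functions h one coordinate at a
    time, the hybrid [g k] having done so for the first k. *)
Lemma expectation_prod_independent d (T : measurableType d) (R : realType)
    (P : probability T R) (n : nat) (z : 'I_n -> {RV P >-> R})
    (h : 'I_n -> R -> R) :
  mutually_independent z ->
  (forall i, measurable_fun setT (h i)) -> (forall i x, 0 <= h i x) ->
  (forall i, (\int[P]_w (h i (z i w))%:E)%E \is a fin_num) ->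
  (\int[P]_w (\prod_(i < n) h i (z i w))%:E =
   \prod_(i < n) \int[P]_w (h i (z i w))%:E)%E.
Proof.
move=> iz mh h0 hfin.
have mzA i A : measurable A -> measurable (z i @^-1` A).
  by move=> mA; rewrite -[X in measurable X]setTI; exact: measurable_funPT.
have EA i A : measurable A -> (\int[P]_w (\1_A (z i w))%:E = P (z i @^-1` A))%E.
  move=> mA; rewrite -[X in _ = P X]setIT -integral_indic//; exact: mzA.
pose g k (A : 'I_n -> set R) (i : 'I_n) :
  R -> R := if (i < k)%N then h i else \1_(A i).
have mg k (A : 'I_n -> set R) i : (forall i,
  measurable (A i)) -> measurable_fun setT (g k A i).
  by move=> mA; rewrite /g; case: ifP.
have g0 k A i x : 0 <= g k A i x by rewrite /g; case: ifP.
have gfin k (A : 'I_n -> set R) i : (forall i,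
  measurable (A i)) -> (\int[P]_w (g k A i (z i w))%:E)%E \is a fin_num.
  move=> mA; rewrite /g; case: ifP => // _; rewrite EA//;
    by apply: fin_num_measure; exact: mzA.
have mz i : measurable_fun setT (z i) by [].
suff H k (A : 'I_n -> set R) : (forall i,
  measurable (A i)) -> (\int[P]_w (\prod_(i < n) g k A i (z i w))%:E =
   \prod_(i < n) \int[P]_w (g k A i (z i w))%:E)%E.
  have := H n (fun=> setT) (fun=> measurableT).
  by rewrite /g; under eq_integral do under eq_bigr do rewrite ltn_ord;
     under [in RHS]eq_bigr do rewrite ltn_ord.
elim: k A => [|k ih] A mA.
  rewrite /g/=.
  transitivity (\int[P]_w (\1_(\bigcap_(i in [set` [set:
    'I_n]%SET]) (z i @^-1` A i)) w)%:E)%E.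
    apply: eq_integral => w _; congr (_%:E).
    rewrite indicE; case: (boolP (w \in _)) => [|].
      rewrite inE => /= Aw; rewrite big1// => i _; rewrite indicE mem_set//.
      by apply: Aw; rewrite /= inE.
    move=> /negP wA.
    have /existsNP[i Ai] : ~ (forall i, A i (z i w)).
      by move=> Aw; apply: wA; rewrite inE => i _; exact: Aw.
    by rewrite (bigD1 i)//= indicE memNset// mul0r.
  rewrite integral_indic//; last first.
    by apply: fin_bigcap_measurable => // i _; exact: mzA.
  rewrite setIT; apply: (etrans (iz [set: 'I_n]%SET A _)) => //.
  by apply: eq_big => i; [rewrite inE|move=> _; rewrite EA].
case: (ltnP k n) => [kn|nk]; last first.
  have -> : g k.+1 A = g k A; last exact: ih.
  by apply/funext => i; rewrite /g !(leq_trans (ltn_ord i))// ltnW.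
pose k0 := Ordinal kn.
have gk i : i != k0 -> g k.+1 A i = g k A i.
  move=> ik; rewrite /g ltnS leq_eqVlt; case: eqP => // ik'.
  by case/eqP: ik; apply/val_inj.
rewrite [in RHS](bigD1 k0)//= muleC.
pose G w := \prod_(i < n | i != k0) g k A i (z i w).
transitivity (\int[P]_w (G w * h k0 (z k0 w))%:E)%E.
  apply: eq_integral => w _; congr (_%:E); rewrite (bigD1 k0)//= mulrC;
    congr (_ * _).
    by apply: eq_bigr => i ik; rewrite gk.
  by rewrite /g ltnSn.
rewrite (@ge0_integral_factor _ _ _ _ _ P (distribution P (z k0)) (z k0) G (h
  k0)
  (\prod_(i < n | i != k0) \int[P]_w (g k A i (z i w))%:E)%E)//.
- congr (_ * _)%E; first by apply: eq_bigr => i ik; rewrite gk.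
  rewrite ge0_integral_distribution//; last by move=> y; rewrite lee_fin.
    by rewrite /g ltnSn.
  exact/measurable_EFinP.
- have -> : G = fun w => \prod_(i < n) (if i != k0 then g k A i (z i w) else 1).
    by apply/funext => w; rewrite /G big_mkcond.
  apply: measurable_prod => i _.
  by case: (i != k0) => //; apply: measurableT_comp => //; exact: mg.
- by move=> w; apply: prodr_ge0.
- apply: (big_ind (fun x => x \is a fin_num)) => // [x y|i _];
    [exact: fin_numM|exact: gfin].
- move=> B mB.
  (* The factorization against the indicator of B is the induction hypothesis with the set at k0
     replaced by B. *)
  pose A' i := if i == k0 then B else A i.
  have mA' i : measurable (A' i) by rewrite /A'; case: ifP.
  have gA' i : i != k0 -> g k A' i = g k A i by rewrite /g /A' => /negPf ->.
  have gB : g k A' k0 = \1_B by rewrite /g /A' ltnn eqxx.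
  have := ih A' mA'; rewrite [in X in _ = X -> _](bigD1 k0)//= gB muleC => H.
  transitivity (\int[P]_w (\prod_(i < n) g k A' i (z i w))%:E)%E.
    apply: eq_integral => w _; congr (_%:E);
      rewrite [RHS](bigD1 k0)//= gB mulrC; congr (_ * _).
    by apply: eq_bigr => i ik; rewrite gA'.
  rewrite H EA//; congr (_ * _)%E; apply: eq_bigr => i ik; by rewrite gA'.
Qed.

Lemma normal_mgf (R : realType) (m : {measure set R -> \bar R}) (s u : R) :
  s != 0 -> (forall A, measurable A -> m A = normal_prob 0 s A) ->
  (\int[m]_x (expR (u * x))%:E)%E = (expR (s ^+ 2 * u ^+ 2 / 2))%:E.
Proof.
move=> s0 mE.
transitivity (\int[lebesgue_measure]_x (normal_pdf 0 s x * expR (u * x))%:E)%E.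
  rewrite -[LHS]mul1e; apply/esym.
  apply: (@ge0_integral_factor _ _ _ _ _ lebesgue_measure m id) => //.
  - exact: measurable_normal_pdf.
  - by move=> x; exact: normal_pdf_ge0.
  - by apply: measurableT_comp => //; exact: mulrl_measurable.
  - move=> A mA; rewrite mul1e mE// /normal_prob [RHS]integral_mkcond/=.
    apply: eq_integral => x _; rewrite patchE indicE.
    by case: ifP; rewrite ?mulr1 ?mulr0.
(* Completing the square: tilting N(0, s^2) by exp (u x) gives a multiple of N(s^2 u, s^2). *)
transitivity (\int[lebesgue_measure]_x ((expR (s ^+ 2 * u ^+ 2 / 2))%:E *
  (normal_pdf (s ^+ 2 * u) s x)%:E))%E.
  apply: eq_integral => x _; rewrite -EFinM; congr (_%:E).
  rewrite !normal_pdfE// [RHS]mulrCA -[LHS]mulrA; congr (_ * _).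
  rewrite /normal_fun -!expRD; congr expR; field; exact: s0.
rewrite ge0_integralZl//.
- by rewrite integral_normal_pdf mule1.
- by apply/measurable_EFinP; exact: measurable_normal_pdf.
- by move=> x _; rewrite lee_fin normal_pdf_ge0.
Qed.

Lemma gaussian_linear_mgf d (T : measurableType d) (R : realType)
    (P : probability T R) (n : nat) (s : R) (z : 'I_n -> {RV P >-> R})
    (u : 'I_n -> R) :
  s != 0 -> iid_gaussian s z ->
  (\int[P]_w (expR (\sum_i u i * z i w))%:E)%E =
  (expR (s ^+ 2 * (\sum_i u i ^+ 2) / 2))%:E.
Proof.
move=> s0 [iz gz].
have me i : measurable_fun setT (fun x : R => expR (u i * x)).
  by apply: measurableT_comp => //; exact: mulrl_measurable.
have mgf i : (\int[P]_w (expR (u i * z i w))%:E)%E = (expR (s ^+ 2 * u i ^+ 2 /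
  2))%:E.
  rewrite -(normal_mgf (m := distribution P (z i)) _ s0); last exact: gz.
  rewrite (@ge0_integral_distribution _ _ _ _ _ _ _ (fun x => (expR (u i *
    x))%:E))//.
  exact/measurable_EFinP.
under eq_integral do rewrite expR_sum.
rewrite (@expectation_prod_independent _ _ _ _ _ _ (fun i x => expR (u i *
  x)))//.
- under eq_bigr do rewrite mgf.
  rewrite prodEFin -expR_sum; congr (expR _)%:E.
  by rewrite mulr_sumr mulr_suml.
- by move=> i; rewrite mgf.
Qed.

(* The Gaussian square is dominated by a mixture of linear exponentials with
   integer exponents: keep the term k = trunc `|x|. *)
Lemma expR_sqr_le_nneseries (R : realType) (x : R) :
  ((expR (2 / 17 * x ^+ 2))%:E <= \sum_(k <oo)
    (expR (4 / 17 - 3 / 4 * k%:R ^+ 2) * (expR (k%:R * x) + expR (- k%:R *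
      x)))%:E)%E.
Proof.
pose u k : \bar R :=
  (expR (4 / 17 - 3 / 4 * k%:R ^+ 2) * (expR (k%:R * x) + expR (- k%:R *
    x)))%:E.
pose q := Num.truncn `|x|.
have u0 k : (0 <= u k)%E by rewrite lee_fin mulr_ge0 ?addr_ge0 ?expR_ge0.
apply: (@le_trans _ _ (u q)).
  have /andP[qx xq] : q%:R <= `|x| < q.+1%:R by apply: truncn_itv.
  have -> : x ^+ 2 = `|x| ^+ 2 by rewrite real_normK ?num_real.
  have : expR (q%:R * `|x|) <= expR (q%:R * x) + expR (- q%:R * x).
    case: (ler0P x) => x0; rewrite ?mulrN -?mulNr ?lerDl ?lerDr expR_ge0//.
  move=> h; rewrite lee_fin; apply: le_trans (ler_wpM2l (expR_ge0 _) h).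
  (* The difference of exponents 4/17 - 3/4 q^2 + q |x| - 2/17 x^2 is concave in |x| and nonnegative
     at |x| = q and |x| = q + 1. *)
  rewrite -expRD ler_expR.
  have q0 : 0 <= q%:R :> R by [].
  rewrite -natr1 in xq.
  move: (`|x|) (q%:R : R) qx xq q0 => y p py yp p0.
  nra.
apply: le_trans (nneseries_lim_ge q.+1 (fun n _ _ => u0 n)).
by rewrite big_nat_recr//= leeDr// sume_ge0.
Qed.

(** Integrate the mixture of linear exponentials term by term: term k costs exp (- 3/4 k^2 + k^2 /
    2), at most exp (- k / 4), which is summable. The weight G lets coordinates be treated one at a
    time. *)
Lemma expectation_expR_sqr_le (R : realType) : exists2 K : R, 0 <= K &
  forall d (T : measurableType d) (P : {measure set T -> \bar R})
    (G w : T -> R) (B : R),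
  measurable_fun setT G -> (forall t, 0 <= G t) -> measurable_fun setT w ->
  (forall s, (\int[P]_t (G t * expR (s * w t))%:E
    <= (B * expR (s ^+ 2 / 2))%:E)%E) ->
  (\int[P]_t (G t * expR (2 / 17 * w t ^+ 2))%:E <= (K * B)%:E)%E.
Proof.
pose r : R := expR (- 4^-1).
have r0 : 0 < r by exact: expR_gt0.
have r1 : r < 1 by rewrite -expR0 ltr_expR oppr_lt0 invr_gt0.
have r1' : 0 < 1 - r by rewrite subr_gt0.
exists (2 * expR (4 / 17) / (1 - r));
  first by rewrite divr_ge0 ?mulr_ge0 ?expR_ge0 ?ltW.
move=> d T P G w B mG G0 mw HB.
have B0 : 0 <= B.
  have := HB 0; rewrite expr0n/= mul0r expR0 mulr1 -lee_fin; apply: le_trans.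
  by apply: integral_ge0 => t _; rewrite lee_fin mulr_ge0 ?expR_ge0.
pose c k : R := expR (4 / 17 - 3 / 4 * k%:R ^+ 2).
pose v k t : \bar R := (G t * (c k * (expR (k%:R * w t) + expR (- k%:R * w
  t))))%:E.
have v0 k t : (0 <= v k t)%E by rewrite lee_fin !mulr_ge0 ?addr_ge0 ?expR_ge0.
have me (a : R) : measurable_fun setT (fun t => expR (a * w t)).
  by apply: measurableT_comp => //; apply: measurable_funM.
have mv k : measurable_fun setT (v k).
  apply/measurable_EFinP; apply: measurable_funM => //;
    apply: measurable_funM => //.
  exact: measurable_funD.
apply: (@le_trans _ _ (\int[P]_t (\sum_(k <oo) v k t))%E).
  apply: ge0_le_integral => //.
  - by move=> t _; rewrite lee_fin mulr_ge0 ?expR_ge0.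
  - apply/measurable_EFinP; apply: measurable_funM => //.
    apply: measurableT_comp => //; apply: measurable_funM => //.
    exact: measurable_funX.
  - by apply: ge0_emeasurable_sum.
  - move=> t _; rewrite EFinM.
    under eq_eseriesr do rewrite /v EFinM.
    rewrite nneseriesZl//; last by move=> k _;
      rewrite lee_fin mulr_ge0 ?addr_ge0 ?expR_ge0.
    by rewrite lee_wpmul2l ?lee_fin//; exact: expR_sqr_le_nneseries.
rewrite integral_nneseries//.
have iv k : (\int[P]_t v k t <= (2 * expR (4 / 17) * B * r ^+ k)%:E)%E.
  have -> : (\int[P]_t v k t = (c k)%:E * (\int[P]_t (G t * expR (k%:R * w
    t))%:E
      + \int[P]_t (G t * expR (- k%:R * w t))%:E))%E.
    rewrite -ge0_integralD//; last 4 first.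
    - by move=> t _; rewrite lee_fin mulr_ge0 ?expR_ge0.
    - by apply/measurable_EFinP; apply: measurable_funM.
    - by move=> t _; rewrite lee_fin mulr_ge0 ?expR_ge0.
    - by apply/measurable_EFinP; apply: measurable_funM.
    rewrite -ge0_integralZl//.
    - by apply: eq_integral => t _; rewrite -EFinD -EFinM; congr (_%:E);
        rewrite mulrCA mulrDr.
    - by apply: emeasurable_funD; apply/measurable_EFinP;
        apply: measurable_funM.
    - by move=> t _; rewrite -EFinD lee_fin addr_ge0// mulr_ge0 ?expR_ge0.
    - by rewrite lee_fin expR_ge0.
  apply: (@le_trans _ _ ((c k)%:E * ((B * expR (k%:R ^+ 2 / 2))%:E + (B * expR
    (k%:R ^+ 2 / 2))%:E))%E).
    rewrite lee_wpmul2l ?lee_fin ?expR_ge0//; apply: leeD; first exact: HB.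
    by have := HB (- k%:R); rewrite sqrrN.
  rewrite -EFinD -EFinM lee_fin.
  have -> : c k * (B * expR (k%:R ^+ 2 / 2) + B * expR (k%:R ^+ 2 / 2)) =
      2 * B * (c k * expR (k%:R ^+ 2 / 2)) by ring.
  have -> : 2 * expR (4 / 17) * B * r ^+ k = 2 * B * (expR (4 / 17) * r ^+ k)
    by ring.
  rewrite ler_wpM2l ?mulr_ge0// /c /r -expRM_natl -!expRD ler_expR.
  have : (k%:R : R) <= k%:R ^+ 2 by rewrite -natrX ler_nat; case: (k) => // k';
    rewrite -mulnn leq_pmulr.
  by set y : R := k%:R => hy; lra.
apply: (@le_trans _ _ (\sum_(k <oo) (2 * expR (4 / 17) * B * r ^+ k)%:E)%E).
  by apply: lee_nneseries => // k _ _; apply: integral_ge0 => t _; exact: v0.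
apply: lime_le.
  by apply: is_cvg_nneseries => k _ _;
    rewrite lee_fin !mulr_ge0 ?exprn_ge0 ?expR_ge0// ltW.
apply: nearW => N; rewrite sumEFin lee_fin -mulr_sumr.
have -> : 2 * expR (4 / 17) / (1 - r) * B = 2 * expR (4 / 17) * B * (1 - r)^-1
  by rewrite -!mulrA; congr (_ * (_ * _)); rewrite mulrC.
rewrite ler_wpM2l ?mulr_ge0 ?expR_ge0//.
by rewrite big_mkord sum_geometric_le// ltW.
Qed.

(** Only the joint moment generating function enters. Linear exponentials are traded for the factors
    with squares one coordinate at a time, while the exponents s of the remaining coordinates stay
    free; K is the constant of a single trade. *)
Lemma subgaussian_prod_le (R : realType) : exists2 K : R, 0 <= K &
  forall d (T : measurableType d) (P : {measure set T -> \bar R}) (m : nat)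
    (w : nat -> T -> R) (b : nat -> R),
  (forall j, measurable_fun setT (w j)) -> (forall j, 0 <= b j) ->
  (forall s : nat -> R, (\int[P]_t (expR (\sum_(j < m) s j * w j t))%:E <=
    (expR ((\sum_(j < m) s j ^+ 2) / 2))%:E)%E) ->
  (\int[P]_t (\prod_(j < m) (1 + b j * expR (2 / 17 * w j t ^+ 2)))%:E <=
    (\prod_(j < m) (1 + K * b j))%:E)%E.
Proof.
have [K K0 HK] := expectation_expR_sqr_le R; exists K => // d T P m w b mw b0 H.
pose F j t := 1 + b j * expR (2 / 17 * w j t ^+ 2).
have F0 j t : 0 <= F j t by rewrite addr_ge0// mulr_ge0// expR_ge0.
have mE j : measurable_fun setT (fun t => expR (2 / 17 * w j t ^+ 2)).
  apply: measurableT_comp => //; apply: measurable_funM => //.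
  exact: measurable_funX.
have mF j : measurable_fun setT (F j).
  by apply: measurable_funD => //; apply: measurable_funM.
pose G i (s : nat -> R) t := \prod_(j < i) F j t * expR (\sum_(i
  <= j < m) s j * w j t).
have mG i s : measurable_fun setT (G i s).
  apply: measurable_funM; first by apply: measurable_prod.
  apply: measurableT_comp => //; apply: measurable_sum => j.
  by apply: measurable_funM.
have G0 i s t : 0 <= G i s t by rewrite mulr_ge0 ?expR_ge0 ?prodr_ge0.
suff claim i s : (i <= m)%N -> (\int[P]_t (G i s t)%:E <=
    (\prod_(j < i) (1 + K * b j) * expR ((\sum_(i
      <= j < m) s j ^+ 2) / 2))%:E)%E.
  have := claim m (fun=> 0) (leqnn m).
  rewrite /G; under eq_integral do rewrite big_geq// expR0 mulr1.
  by rewrite big_geq// mul0r expR0 mulr1.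
elim: i s => [|i ih] s im.
  rewrite /G; under eq_integral do rewrite big_ord0 mul1r big_mkord.
  by rewrite big_ord0 mul1r big_mkord; exact: H.
pose g t := \prod_(j < i) F j t * expR (\sum_(i.+1 <= j < m) s j * w j t).
have mg : measurable_fun setT g.
  apply: measurable_funM; first by apply: measurable_prod.
  apply: measurableT_comp => //; apply: measurable_sum => j.
  by apply: measurable_funM.
have g0 t : 0 <= g t by rewrite mulr_ge0 ?expR_ge0 ?prodr_ge0.
pose B := \prod_(j < i) (1 + K * b j) * expR ((\sum_(i.+1
  <= j < m) s j ^+ 2) / 2).
have gB a : (\int[P]_t (g t * expR (a * w i t))%:E
  <= (B * expR (a ^+ 2 / 2))%:E)%E.
  pose s' j := if j == i then a else s j.
  have E1 (f : R -> nat -> R) : \sum_(i <= j < m) f (s' j) j = f a i +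
    \sum_(i.+1 <= j < m) f (s j) j.
    rewrite big_ltn// /s' eqxx; congr (_ + _);
      apply: eq_big_nat => j /andP[ij _].
    by rewrite gtn_eqF.
  have := ih s' (ltnW im); rewrite /G (E1 (fun x _ => x ^+ 2)).
  under eq_integral => t _ do rewrite (E1 (fun x j => x * w j t)) addrC expRD
    mulrA.
  by rewrite addrC mulrDl expRD mulrA.
have -> : (\int[P]_t (G i.+1 s t)%:E = \int[P]_t (g t)%:E +
    (b i)%:E * \int[P]_t (g t * expR (2 / 17 * w i t ^+ 2))%:E)%E.
  have mgE : measurable_fun setT (fun t => (g t * expR (2 / 17 * w i t ^+
    2))%:E).
    by apply/measurable_EFinP; apply: measurable_funM.
  rewrite -ge0_integralZl//; last 2 first.
  - by move=> t _; rewrite lee_fin mulr_ge0 ?expR_ge0.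
  - by rewrite lee_fin.
  rewrite -ge0_integralD//.
  - apply: eq_integral => t _; rewrite -EFinM -EFinD; congr (_%:E).
    by rewrite /G /g big_ord_recr/= /F; ring.
  - by move=> t _; rewrite lee_fin.
  - exact/measurable_EFinP.
  - by move=> t _; rewrite -EFinM lee_fin mulr_ge0// mulr_ge0 ?expR_ge0.
  - exact: measurable_funeM.
rewrite big_ord_recr/= mulrAC -/B.
apply: (@le_trans _ _ (B%:E + (b i)%:E * (K * B)%:E)%E).
  apply: leeD.
    have := gB 0; rewrite expr0n/= mul0r expR0 mulr1.
    by under eq_integral do rewrite mul0r expR0 mulr1.
  by rewrite lee_wpmul2l ?lee_fin//; exact: HK.
rewrite -EFinM -EFinD lee_fin le_eqVlt; apply/orP; left; apply/eqP; ring.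
Qed.

(** * The least squares estimator *)

Lemma enorm_sqr (R : realType) (n : nat) (u : 'rV[R]_n) :
  enorm u ^+ 2 = \sum_i u 0 i ^+ 2.
Proof. by rewrite /enorm sqr_sqrtr// sumr_ge0// => i _; exact: sqr_ge0. Qed.

Lemma concave_cone_convex (R : realType) (n : nat) (u v : 'rV[R]_n) (s : R) :
  0 <= s <= 1 -> concave_cone u -> concave_cone v ->
  concave_cone (u + s *: (v - u)).
Proof.
move=> /andP[s0 s1] cu cv i j k ij jk; have := cu i j k ij jk;
  have := cv i j k ij jk.
by rewrite !mxE; nra.
Qed.

Lemma closed_concave_cone (R : realType) (n : nat) :
  closed (@concave_cone R n).
Proof.
have -> : @concave_cone R n = \bigcap_(p in [set p : 'I_n * 'I_n * 'I_n |
    nat_of_ord p.1.2 = p.1.1.+1 /\ nat_of_ord p.2 = p.1.2.+1])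
    ((fun u : 'rV[R]_n => (u 0 p.1.2 - u 0 p.1.1) - (u 0 p.2 - u 0 p.1.2))
      @^-1` [set x | 0 <= x]).
  apply/seteqP; split => [u cu [[i j] k]/= [ij jk]|u cu i j k ij jk].
    by rewrite /= subr_ge0; exact: cu.
  by have := cu (i, j, k) (conj ij jk); rewrite /= subr_ge0.
apply: closed_bigI => -[[i j] k] _ /=.
apply: preimage_closed; last exact: closed_ge.
move=> u _; have cc l := @coord_continuous R 1 n 0 l u.
exact: (continuousB (continuousB (cc j) (cc i)) (continuousB (cc k) (cc j))).
Qed.

Lemma continuous_sum_sqr (R : realType) (n : nat) (y : 'rV[R]_n) :
  continuous (fun u : 'rV[R]_n => \sum_i (y 0 i - u 0 i) ^+ 2).
Proof.
elim: (index_enum _) => [|i s ih] u.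
  rewrite (_ : (fun _ => _) = cst 0); first exact: cst_continuous.
  by apply/funext => v; rewrite big_nil.
have ci : {for u, continuous (fun u : 'rV[R]_n => y 0 i - u 0 i)}.
  exact: (continuousB (@cst_continuous _ _ _ _) (@coord_continuous R 1 n 0 i
    u)).
rewrite (_ : (fun _ => _) = (fun v : 'rV[R]_n => (y 0 i - v 0 i) * (y 0 i - v 0
  i)) \+
    (fun v : 'rV[R]_n => \sum_(j <- s) (y 0 j - v 0 j) ^+ 2)).
  exact: (continuousD (continuousM ci ci) (ih u)).
by apply/funext => v; rewrite big_cons.
Qed.

(** Existence by compactness: it suffices to minimize over the elements of the cone that do at least
    as well as 0, a closed and bounded set. *)
Lemma lse_minimizes (R : realType) (n : nat) (y : 'rV[R]_n) :
  concave_cone (lse y) /\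
  forall u, concave_cone u -> enorm (y - lse y) ^+ 2 <= enorm (y - u) ^+ 2.
Proof.
rewrite /lse; case: xgetP => [t _ //|none]; exfalso.
pose f (u : 'rV[R]_n) := \sum_i (y 0 i - u 0 i) ^+ 2.
have fE u : enorm (y - u) ^+ 2 = f u.
  by rewrite enorm_sqr; apply: eq_bigr => i _; rewrite !mxE.
pose S := f 0.
have f0 u : 0 <= f u by apply: sumr_ge0 => i _; exact: sqr_ge0.
pose A := @concave_cone R n `&` f @^-1` [set x | x <= S].
have c0 : concave_cone (0 : 'rV[R]_n) by move=> i j k _ _; rewrite !mxE.
have A0 : A !=set0 by exists 0; split => //=; exact: lexx.
have cA : compact A.
  (* Both |y_i| and |y_i - u_i| are at most sqrt S, so |u_i| <= 2 sqrt S <= 2 + 2 S. *)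
  apply: (@subclosed_compact _ _ [set v : 'rV[R]_n | forall i, `[- (2 + 2 * S),
    2 + 2 * S]%classic (v ord0 i)]).
  - apply: closedI; first exact: closed_concave_cone.
    apply: preimage_closed; last exact: closed_le.
    by move=> u _; exact: continuous_sum_sqr.
  - by apply: (@rV_compact R n (fun=> `[- (2 + 2 * S),
      2 + 2 * S]%classic)) => i; exact: segment_compact.
  - move=> u [_ /= fu] i; rewrite in_itv/= -ler_norml.
    have Hi (v : 'rV[R]_n) : (y 0 i - v 0 i) ^+ 2 <= f v.
      by rewrite /f (bigD1 i)//= lerDl sumr_ge0// => j _; exact: sqr_ge0.
    have h1 := Hi u; have h2 : y 0 i ^+ 2 <= S by have := Hi 0;
      rewrite mxE subr0.
    have S0 : 0 <= S by exact: f0.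
    rewrite -ler_sqr ?nnegrE ?addr_ge0 ?mulr_ge0// real_normK ?num_real//.
    have {}h1 := le_trans h1 fu.
    move: (y 0 i) (u 0 i) h1 h2 => a b h1 h2.
    have := sqr_ge0 (2 * a - b); have := sqr_ge0 S; nra.
have cf : {within A, continuous f} by apply: continuous_subspaceT => u;
  exact: continuous_sum_sqr.
have [c /set_mem[cc fc] cmin] := compact_EVT_min A0 cA cf.
apply: (none c); split => // u cu; rewrite !fE.
have [uS|/ltW Su] := leP (f u) S; first by apply: cmin; rewrite inE; split.
exact: le_trans fc Su.
Qed.

(** The obtuse angle criterion for projections: moving a fraction s from the minimizer towards u
    stays in the cone and cannot improve the fit. *)
Lemma lse_variational (R : realType) (n : nat) (y u : 'rV[R]_n) :
  concave_cone u ->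
  \sum_i (y 0 i - lse y 0 i) * (u 0 i - lse y 0 i) <= 0.
Proof.
move=> cu; have [cl lmin] := lse_minimizes y.
set a := \sum_i _; set t := lse y in a cl lmin *.
pose b := \sum_i (u 0 i - t 0 i) ^+ 2.
have b0 : 0 <= b by apply: sumr_ge0 => i _; exact: sqr_ge0.
have key s : 0 <= s <= 1 -> 2 * s * a <= s ^+ 2 * b.
  move=> s01; have := lmin _ (concave_cone_convex s01 cl cu).
  rewrite !enorm_sqr => h; rewrite -subr_ge0 /a /b !mulr_sumr -sumrB.
  move: h; rewrite -subr_ge0 -sumrB => h.
  apply: le_trans h _; apply: ler_sum => i _; rewrite !mxE le_eqVlt; apply/orP;
    left; apply/eqP; ring.
rewrite leNgt; apply/negP => a0.
(* The fraction s = a / (a + b) satisfies s b < a, contradicting 2 a <= s b. *)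
have ab : 0 < a + b by rewrite ltr_wpDr.
have s01 : 0 <= a / (a + b) <= 1.
  apply/andP; split; first by rewrite divr_ge0// ltW.
  by rewrite ler_pdivrMr// mul1r lerDl.
have := key _ s01; set s := a / (a + b).
have s0 : 0 < s by rewrite divr_gt0.
have sab : s * (a + b) = a by rewrite /s divfK// gt_eqF.
nra.
Qed.

Lemma lse_basic_inequality (R : realType) (n : nat) (t z : 'rV[R]_n) :
  concave_cone t ->
  \sum_i (lse (t + z) 0 i - t 0 i) ^+ 2 <=
  \sum_i z 0 i * (lse (t + z) 0 i - t 0 i).
Proof.
move=> ct; have := lse_variational (t + z) ct; rewrite -oppr_ge0 -sumrN.
move=> h; rewrite -subr_ge0 -sumrB; apply: le_trans h _.
by apply: ler_sum => i _; rewrite !mxE le_eqVlt; apply/orP; left; apply/eqP;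
  ring.
Qed.

(** Projections are nonexpansive: add the two variational inequalities. The l1 form is the one used
    for measurability. *)
Lemma lse_coord_lipschitz (R : realType) (n : nat) (y y' : 'rV[R]_n) (i :
  'I_n) :
  lse y 0 i <= lse y' 0 i + \sum_j `|y 0 j - y' 0 j|.
Proof.
have h1 := lse_variational y (lse_minimizes y').1.
have h2 := lse_variational y' (lse_minimizes y).1.
set a := lse y in h1 h2 *; set b := lse y' in h1 h2 *.
have h3 : \sum_j (a 0 j - b 0 j) ^+ 2 <= \sum_j (y 0 j - y' 0 j) ^+ 2.
  have : 0 <= 2 * (- \sum_j (y 0 j - a 0 j) * (b 0 j - a 0 j) - \sum_j (y' 0 j
    - b 0 j) * (a 0 j - b 0 j)) by lra.
  rewrite -sumrN -sumrB mulr_sumr => h; rewrite -subr_ge0 -sumrB;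
    apply: le_trans h _.
  by apply: ler_sum => j _; have := sqr_ge0 ((y 0 j - y' 0 j) - (a 0 j - b 0
    j)); nra.
have h4 : \sum_j (y 0 j - y' 0 j) ^+ 2 <= (\sum_j `|y 0 j - y' 0 j|) ^+ 2.
  rewrite expr2 mulr_suml; apply: ler_sum => j _.
  rewrite -real_normK ?num_real// expr2 ler_wpM2l// (bigD1 j)//= lerDl
    sumr_ge0//.
have h5 : (a 0 i - b 0 i) ^+ 2 <= (\sum_j `|y 0 j - y' 0 j|) ^+ 2.
  apply: le_trans h4; apply: le_trans h3;
    rewrite (bigD1 i)//= lerDl sumr_ge0// => j _; exact: sqr_ge0.
rewrite -lerBlDl; apply: le_trans (ler_norm _) _.
rewrite -ler_sqr ?nnegrE ?sumr_ge0// real_normK ?num_real//.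
Qed.

(** A Lipschitz f is the infimum over rational points q of f(q) + |y - q|_1, so its strict sublevel
    sets are countable unions of measurable sets. *)
Lemma measurable_lipschitz d (T : measurableType d) (R : realType) (n : nat)
    (f : 'rV[R]_n -> R) (z : 'I_n -> T -> R) :
  (forall y y', f y <= f y' + \sum_i `|y 0 i - y' 0 i|) ->
  (forall i, measurable_fun setT (z i)) ->
  measurable_fun setT (fun w => f (\row_i z i w)).
Proof.
move=> lf mz; apply: (measurability _ (RGenInftyO.measurableE R)) => //.
move=> _ [_ [c ->] <-]; rewrite setTI.
pose q' (q : 'rV[rat]_n) : 'rV[R]_n := \row_i ratr (q 0 i).
pose g q w := f (q' q) + \sum_i `|z i w - q' q 0 i|.
rewrite [X in measurable X](_ : _ = \bigcup_q (g q @^-1` `]-oo, c[%classic)).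
  apply: countable_bigcupT_measurable => [|q]; first exact: countableP.
  rewrite -[X in measurable X]setTI.
  have : measurable_fun setT (g q).
    apply: measurable_funD => //; apply: measurable_sum => i.
    by apply: measurableT_comp => //; apply: measurable_funB.
  by apply => //; exact: measurable_itv.
apply/seteqP; split => w /=.
  rewrite in_itv/= => fc.
  (* Passing to a rational point and back costs at most 2 n e, strictly less than the gap c - f. *)
  pose e := (c - f (\row_i z i w)) / (2 * n.+1%:R).
  have e0 : 0 < e by rewrite divr_gt0 ?subr_gt0// mulr_gt0.
  have /choice[q qe] i : exists q : rat, `|z i w - ratr q| <= e.
    have [q] := @rat_in_itvoo R (z i w - e) (z i w + e) ltac:(lra).
    by rewrite in_itv/= => /andP[q1 q2]; exists q; rewrite ler_norml; lra.
  exists (\row_i q i) => //=; rewrite in_itv/= /g.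
  set s := \sum_i _.
  have se : s <= n%:R * e.
    rewrite -[n in leRHS]card_ord -sum1_card natr_sum mulr_suml;
      apply: ler_sum => i _.
    by rewrite !mxE mul1r; exact: qe.
  have : f (q' (\row_i q i)) <= f (\row_i z i w) + s.
    apply: le_trans (lf _ (\row_i z i w)) _; rewrite lerD2l.
    by apply: ler_sum => i _; rewrite distrC [X in `|X - _|]mxE.
  have : 2 * n.+1%:R * e = c - f (\row_i z i w)
    by rewrite /e mulrC divfK// mulf_neq0.
  rewrite -natr1 => h1 h2.
  have h3 : 2 * (n%:R * e) + 2 * e = c - f (\row_i z i w) by rewrite -h1; ring.
  lra.
move=> [q _]; rewrite /= !in_itv/= /g; apply: le_lt_trans.
apply: le_trans (lf _ (q' q)) _; rewrite lerD2l.
by apply: ler_sum => i _; rewrite [X in `|X - _|]mxE.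
Qed.

Lemma measurable_lse_loss d (T : measurableType d) (R : realType)
    (P : probability T R) (n : nat) (t : 'rV[R]_n) (z : 'I_n -> {RV P >-> R}) :
  measurable_fun setT (lse_loss t z).
Proof.
rewrite (_ : lse_loss t z = fun w => n%:R^-1 *
    \sum_i (lse (\row_j (t 0 j + z j w)) 0 i - t 0 i) ^+ 2); last first.
  apply/funext => w; rewrite /lse_loss enorm_sqr; congr (_ * _).
  rewrite (_ : t + _ = \row_j (t 0 j + z j w)); last by apply/rowP => j;
    rewrite !mxE.
  by apply: eq_bigr => i _; rewrite !mxE.
apply: measurable_funM => //; apply: measurable_sum => i;
  apply: measurable_funX.
apply: measurable_funB => //.
apply: (@measurable_lipschitz _ _ _ _ (fun y => lse y 0 i) (fun j w => t 0 j +
  z j w)).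
  by move=> y y'; exact: lse_coord_lipschitz.
by move=> j; apply: measurable_funD.
Qed.

(** * Proof of the risk bounds *)

(* Analysis is an isometry by Parseval, so its adjoint is a contraction. *)
Lemma frame_synthesis_le (R : rcfType) (n : nat) (E : seq ((nat -> R) * R))
    (s : nat -> R) (e0 : (nat -> R) * R) :
  (forall x y, \sum_(e <- E) e.1 x * e.1 y = ((x == y) && (x < n)%N)%:R) ->
  \sum_(x < n) (\sum_(j < size E) s j * (nth e0 E j).1 x) ^+ 2 <=
  \sum_(j < size E) s j ^+ 2.
Proof.
move=> KE; pose U x := \sum_(j < size E) s j * (nth e0 E j).1 x.
have := @frame_parseval R n E (fun x => x < n)%N KE U U.
rewrite [in RHS](eq_bigl xpredT); last by move=> x; rewrite ltn_ord.
rewrite (big_nth e0) big_mkord => PU.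
have UE : \sum_(x < n) U x ^+ 2 = \sum_(j < size E) s j * ip n (nth e0 E j).1 U.
  rewrite /ip; under [RHS]eq_bigr do rewrite mulr_sumr.
  rewrite exchange_big /=; apply: eq_bigr => x _.
  rewrite expr2 {1}/U mulr_suml; apply: eq_bigr => j _; ring.
have : \sum_(j < size E) s j * ip n (nth e0 E j).1 U <=
    \sum_(j < size E) (s j ^+ 2 / 2 + (ip n (nth e0 E j).1 U * ip n (nth e0 E
      j).1 U) / 2).
  apply: ler_sum => j _; have := sqr_ge0 (s j - ip n (nth e0 E j).1 U); lra.
rewrite -UE big_split /= -!mulr_suml PU.
under [X in _ + X / 2]eq_bigr do rewrite -expr2.
lra.
Qed.

(** Write |a| <= max (0, |a| - tau) + tau for each noise coefficient and apply Young's inequality to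
    the first part; by Parseval the quadratic terms in u sum to half of its squared norm, which is
    absorbed on the left. *)
Lemma frame_basic_bound (R : rcfType) (n : nat) (E : seq ((nat -> R) * R))
    (B : R) (g u : nat -> R) :
  (forall x y, \sum_(e <- E) e.1 x * e.1 y = ((x == y) && (x < n)%N)%:R) ->
  \sum_(x < n) u x ^+ 2 <= \sum_(x < n) g x * u x ->
  \sum_(e <- E) e.2 * `|ip n e.1 u| <= B ->
  \sum_(x < n) u x ^+ 2 <=
  \sum_(e <- E) Num.max 0 (`|ip n e.1 g| - e.2) ^+ 2 + 2 * B.
Proof.
move=> KE basic bias.
have parseval f h : \sum_(e <- E) ip n e.1 f * ip n e.1 h = \sum_(x < n) f x *
  h x.
  rewrite (@frame_parseval R n E (fun x => x < n)%N KE).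
  by apply: eq_bigl => x; rewrite ltn_ord.
have uu : \sum_(e <- E) ip n e.1 u * ip n e.1 u = \sum_(x < n) u x ^+ 2.
  by rewrite parseval; apply: eq_bigr => x _; rewrite expr2.
have : \sum_(x < n) g x * u x <=
   \sum_(e <- E) (Num.max 0 (`|ip n e.1 g| - e.2) ^+ 2 / 2 +
     (ip n e.1 u * ip n e.1 u) / 2 + e.2 * `|ip n e.1 u|).
  rewrite -parseval; apply: ler_sum => e _.
  set a := ip n e.1 g; set b := ip n e.1 u; set m := Num.max _ _.
  have h1 : a * b <= `|a| * `|b| by rewrite -normrM ler_norm.
  have h2 : `|a| <= m + e.2 by rewrite -lerBlDr le_max lexx orbT.
  have h3 := ler_wpM2r (normr_ge0 b) h2.
  have h4 : `|b| ^+ 2 = b * b by rewrite real_normK ?num_real// expr2.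
  have := sqr_ge0 (m - `|b|); move: h1 h3 h4; clear; lra.
rewrite !big_split /= -!mulr_suml uu; move: basic bias; lra.
Qed.

(** Below the threshold the left side is 1; above it (|w| - tau)^2 <= w^2 - tau^2. *)
Lemma expR_threshold_le (R : realType) (w tau : R) : 0 <= tau ->
  expR (2 / 17 * Num.max 0 (`|w| - tau) ^+ 2) <=
  1 + expR (- (2 / 17 * tau ^+ 2)) * expR (2 / 17 * w ^+ 2).
Proof.
move=> t0; have [wt|tw] := leP (`|w| - tau) 0.
  by rewrite expr0n/= mulr0 expR0 lerDl mulr_ge0 ?expR_ge0.
rewrite -expRD; apply: (@le_trans _ _ (expR (- (2 / 17 * tau ^+ 2) + 2 / 17 * w
  ^+ 2))); last first.
  by rewrite lerDr.
rewrite ler_expR -[w ^+ 2]real_normK ?num_real//.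
have : 0 <= `|w| by []. move: `|w| tw => a ta _; nra.
Qed.

(** The slope 4 of the thresholds makes this work: i <= i^2 and exp (32/17) >= (25/17)^4 >= 4. *)
Lemma expR_sqr_le_quarter (R : realType) (i : nat) :
  expR (- (2 / 17 * (4 * i%:R) ^+ 2)) <= 4^-1 ^+ i :> R.
Proof.
have h : 4 <= expR (32 / 17) :> R.
  have h8 : 25 / 17 <= expR (8 / 17) :> R by apply: le_trans (expR_ge1Dx _);
    lra.
  rewrite (_ : 32 / 17 = 4%:R * (8 / 17)); last by field.
  rewrite expRM_natl; apply: (@le_trans _ _ ((25 / 17) ^+ 4)); first by lra.
  by apply: lerXn2r; rewrite ?nnegrE ?expR_ge0//; lra.
apply: (@le_trans _ _ (expR (i%:R * (- (32 / 17))))).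
  rewrite ler_expR.
  have : (i%:R : R) <= i%:R ^+ 2.
    by rewrite -natrX ler_nat; case: (i) => // k; rewrite -mulnn leq_pmulr.
  by move: (i%:R : R) => y; lra.
rewrite expRM_natl; apply: lerXn2r; rewrite ?nnegrE ?expR_ge0 ?invr_ge0//.
by rewrite expRN lef_pV2 ?posrE ?expR_gt0.
Qed.

(** * From an exponential moment to tail and mean *)

Lemma expmoment_scale d (T : measurableType d) (R : realType)
    (P : probability T R) (X : T -> R) (A B c : R) :
  measurable_fun setT X ->
  (\int[P]_w (expR ((X w - A) / 17))%:E <= (expR B)%:E)%E ->
  measurable_fun setT (fun w => (expR ((X w - A) / 17))%:E) /\
  (\int[P]_w ((expR c)%:E * (expR ((X w - A) / 17))%:E) <=
    (expR (c + B))%:E)%E.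
Proof.
move=> mX HX.
have mexp : measurable_fun setT (fun w => (expR ((X w - A) / 17))%:E).
  apply/measurable_EFinP; apply: measurableT_comp => //.
  by apply: measurable_funM => //; exact: measurable_funB.
split => //; rewrite ge0_integralZl// ?lee_fin ?expR_ge0//.
by rewrite expRD EFinM lee_wpmul2l// lee_fin expR_ge0.
Qed.

Lemma expmoment_tail d (T : measurableType d) (R : realType)
    (P : probability T R) (X : T -> R) (A B x : R) :
  measurable_fun setT X ->
  (\int[P]_w (expR ((X w - A) / 17))%:E <= (expR B)%:E)%E ->
  ((1 - expR (- x))%:E <= P [set w | (X w <= 17 * x + A + 17 * B)%R])%E.
Proof.
(* With the factor exp (- x - B) the integrand is at least 1 outside the event, and its integral is
   at most exp (- x). *)
move=> mX HX; have [mexp] := expmoment_scale (- x - B) mX HX.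
rewrite subrK => tail_le; set S := [set w | _].
have mS : measurable S.
  rewrite -[S]setTI; rewrite (_ : S = X @^-1` `]-oo,
    (17 * x + A + 17 * B)]%classic).
    by apply: mX => //; exact: measurable_itv.
  by apply/seteqP; split => w /=; rewrite in_itv.
have : (P (~` S) <= (expR (- x))%:E)%E.
  rewrite -[X in P X]setIT -integral_indic//; last exact: measurableC.
  apply: le_trans tail_le.
  apply: ge0_le_integral => //.
  - by apply/measurable_EFinP; apply: measurable_indic; exact: measurableC.
  - exact: measurable_funeM.
  - move=> w _; rewrite -EFinM lee_fin -expRD indicE.
    case: (boolP (w \in _)) => [|_]; last by rewrite expR_ge0.
    rewrite inE /S /= => /negP; rewrite -ltNge => Xw.
    apply: le_trans (expR_ge1Dx _); rewrite [leLHS](_ : _ = 1)// lerDl.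
    by lra.
rewrite probability_setC// => h.
have : (1 - P S + P S <= (expR (- x))%:E + P S)%E by rewrite leeD2r.
rewrite subeK ?fin_num_measure// EFinB => h'.
by rewrite leeBlDl.
Qed.

Lemma expmoment_mean d (T : measurableType d) (R : realType)
    (P : probability T R) (X : T -> R) (A B : R) :
  measurable_fun setT X ->
  (\int[P]_w (expR ((X w - A) / 17))%:E <= (expR B)%:E)%E ->
  (forall w, 0 <= X w) -> 0 <= A + 17 * B ->
  (\int[P]_w (X w)%:E <= (A + 17 * B + 17)%:E)%E.
Proof.
move=> mX HX X0 AB0; have [mexp] := expmoment_scale (- B) mX HX.
rewrite addNr expR0 => mean_le.
apply: (@le_trans _ _ (\int[P]_w ((A + 17 * B)%:E + (17%:R)%:E * ((expR (-
  B))%:E * (expR ((X w - A) / 17))%:E)))%E).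
  apply: ge0_le_integral => //.
  - by move=> w _; rewrite lee_fin.
  - exact/measurable_EFinP.
  - by apply: emeasurable_funD => //; apply: measurable_funeM;
      exact: measurable_funeM.
  - move=> w _; rewrite -!EFinM -EFinD lee_fin -expRD.
    by have := expR_ge1Dx (- B + (X w - A) / 17); lra.
rewrite ge0_integralD//; last by apply: measurable_funeM;
  exact: measurable_funeM.
rewrite integral_cst//= probability_setT mule1.
rewrite ge0_integralZl//; last exact: measurable_funeM.
rewrite [leRHS]EFinD; apply: leeD2l.
by rewrite -[leRHS]mule1 lee_wpmul2l.
Qed.

Lemma spread_ge (R : realType) (n : nat) (t : 'rV[R]_n.+1) (i j : 'I_n.+1) :
  `|t 0 i - t 0 j| <= spread t.
Proof.
have M k : t 0 k <= \big[Num.max/t 0 ord0]_(i < n.+1) t 0 i by exact: le_bigmax.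
have m k : \big[Num.min/t 0 ord0]_(i < n.+1) t 0 i <= t 0 k by exact: bigmin_le.
have := M i; have := M j; have := m i; have := m j.
by rewrite /spread ler_norml => h1 h2 h3 h4; apply/andP; split; lra.
Qed.

Lemma PL_affine (R : realType) (n : nat) (t : 'rV[R]_n) :
  exists a b : R, forall i, (t *m PL R n) 0 i = a + b * i%:R.
Proof.
have : (t *m PL R n <= affine_space R n)%MS by exact: proj_mx_sub.
move=> /sub_addsmxP[[u1 u2] /= ->].
(* Indices start at 0, so the coefficient of (1, ..., n) enters the constant term too. *)
exists (u1 0 0 + u2 0 0), (u2 0 0) => i.
by rewrite !mxE !big_ord1 !mxE -natr1; ring.
Qed.

Lemma log2_bounds (R : realType) (x : R) : 1 <= x ->
  exists v : nat, (2 ^ v)%:R <= x /\ x <= (2 ^ v.+1)%:R.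
Proof.
move=> x1; exists (trunc_log 2 (Num.truncn x)).
have x0 : 0 <= x by apply: le_trans x1.
have /andP[t1 t2] := truncn_itv x0.
have tp : (0 < Num.truncn x)%N by rewrite truncn_gt0.
split.
  by apply: le_trans t1; rewrite ler_nat trunc_logP.
by apply: le_trans (ltW t2) _; rewrite ler_nat; apply: trunc_log_ltn.
Qed.

Lemma concave_upto_row (R : realType) (n : nat) (t : 'rV[R]_n.+1) (a b s : R) :
  0 < s -> concave_cone t ->
  concave_upto n.+1 (fun x => t 0 (inord x) / s - (a + b * x%:R)).
Proof.
move=> s0 ct x xn; rewrite /slope -!natr1.
have := ct (inord x) (inord x.+1) (inord x.+2).
have x1 := ltnW xn; have x0 := ltnW x1.
rewrite !inordK//.
move=> /(_ erefl erefl); rewrite -(ler_pM2r (_ : 0 < s^-1)) ?invr_gt0// !mulrBl.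
lra.
Qed.

(** After division by sigma the noise is standard and V is at least 1. Pointwise, the scaled loss
    minus C1 M is at most twice the sum of squared thresholded noise coefficients; the exponential
    moment of that sum is governed by the count of the frame, of order M. *)
Lemma lse_expmoment (R : realType) : exists C1 C2 : R,
  [/\ 0 <= C1, 0 <= C2 &
  forall (n : nat) (sigma : R) (theta : 'rV[R]_n.+1)
    (d : measure_display) (T : measurableType d) (P : probability T R)
    (z : 'I_n.+1 -> {RV P >-> R}) (V M : R),
  0 < sigma -> concave_cone theta -> iid_gaussian sigma z ->
  V = (spread (theta *m (1%:M - PL R n.+1)) + sigma) / sigma ->
  M = (n.+1%:R * V ^+ 2) `^ (1 / 5) ->
  (\int[P]_w (expR ((n.+1%:R * lse_loss theta z w / sigma ^+ 2 - C1 * M) /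
    17))%:E <=
   (expR (C2 * M))%:E)%E].
Proof.
pose q : R := 2 `^ (1 / 10).
have q10 : q ^+ 10 = 2.
  rewrite -powR_mulrn ?powR_ge0// /q -powRrM (_ : 1 / 10 * 10%:R = 1);
    last by field.
  by rewrite powRr1.
have q1 : 1 < q.
  rewrite ltNge; apply/negP => q1.
  have : q ^+ 10 <= 1 by rewrite exprn_ile1// powR_ge0.
  by rewrite q10 leNgt ltr1n.
have [C C0 HC] := whitney_frame q1 q10.
have [K K0 HK] := subgaussian_prod_le R.
exists (4 * (C + C ^+ 2)), (K * C); split.
- by rewrite mulr_ge0// addr_ge0// sqr_ge0.
- by rewrite mulr_ge0.
move=> n sigma theta d T P z V M s0 ct iidz VE ME.
have s0' : sigma != 0 by rewrite gt_eqF.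
set th0 := theta *m _ in VE.
have sp0 : 0 <= spread th0 by have := spread_ge th0 0 0; rewrite subrr normr0.
have V1 : 1 <= V by rewrite VE ler_pdivlMr// mul1r lerDr.
have V0 : 0 <= V by apply: le_trans V1.
have [v [v1 v2]] : exists v : nat, (2 ^ v)%:R <= V ^+ 2 /\ V ^+ 2
  <= (2 ^ v.+1)%:R.
  by apply: log2_bounds; rewrite exprn_ege1.
have [E [M0 [[M00 M05] E0 Eker Ecount Ebias]]] := HC n.+1 v V isT V0 v1 v2.
have nV1 : 1 <= n.+1%:R * V ^+ 2 by rewrite mulr_ege1// ?ler1n// exprn_ege1.
have M1 : 1 <= M.
  by rewrite ME; have := ler_powR nV1 (_ : 0 <= 1 / 5); rewrite powRr0; apply;
    lra.
have M0M : M0 <= M.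
  have -> : M0 = (M0 ^+ 5) `^ (1 / 5).
    by rewrite -powR_mulrn// -powRrM (_ : 5%:R * (1 / 5) = 1) ?powRr1//; field.
  rewrite ME; apply: ge0_ler_powR; rewrite ?nnegrE ?exprn_ge0//.
  by apply: le_trans nV1.
have [a [b abE]] := PL_affine theta.
(* Subtracting P_L theta and the first entry of the residual leaves a concave sequence that vanishes
   at 0 and is bounded by spread / sigma, hence by V. *)
pose A x := (a + b * x%:R) / sigma + th0 0 0 / sigma.
pose g w x := z (inord x) w / sigma.
pose X w := n.+1%:R * lse_loss theta z w / sigma ^+ 2.
pose G w := \prod_(e <- E) (1 + expR (- (2 / 17 * e.2 ^+ 2)) * expR (2 / 17 *
  ip n.+1 e.1 (g w) ^+ 2)).
have pointwise w : expR ((X w - 4 * (C + C ^+ 2) * M) / 17) <= G w.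
  pose y := theta + \row_i z i w.
  pose f x := lse y 0 (inord x) / sigma - A x.
  pose f0 x := theta 0 (inord x) / sigma - A x.
  pose u x := f x - f0 x.
  have AE x : A x = (a / sigma + th0 0 0 / sigma) + (b / sigma) * x%:R
    by rewrite /A; ring.
  have cf : concave_upto n.+1 f.
    have := concave_upto_row (a / sigma + th0 0 0 / sigma) (b / sigma) s0
      (lse_minimizes y).1.
    by move=> h x; have := h x; rewrite /slope /f !AE.
  have cf0 : concave_upto n.+1 f0.
    have := concave_upto_row (a / sigma + th0 0 0 / sigma) (b / sigma) s0 ct.
    by move=> h x; have := h x; rewrite /slope /f0 !AE.
  have f0V x : (x < n.+1)%N -> `|f0 x| <= V.
    move=> xn; rewrite /f0 /A VE.
    have -> : theta 0 (inord x) / sigma - ((a + b * x%:R) / sigma + th0 0 0 /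
      sigma) =
        (th0 0 (inord x) - th0 0 0) / sigma.
      have -> : th0 0 (inord x) = theta 0 (inord x) - (a + b * x%:R).
        rewrite /th0 mulmxBr mulmx1; have := abE (inord x); rewrite inordK//.
        by move: (theta *m PL R n.+1) => B <-; rewrite !mxE.
      by ring.
    rewrite normrM [`|sigma^-1|]ger0_norm ?invr_ge0 ?(ltW s0)//.
    rewrite ler_pM2r ?invr_gt0//.
    by apply: le_trans (spread_ge _ _ _) _; rewrite lerDl ltW.
  have uE (i : 'I_n.+1) : u i = (lse y 0 i - theta 0 i) / sigma.
    by rewrite /u /f /f0 inord_val; ring.
  have XE : X w = \sum_(i < n.+1) u i ^+ 2.
    rewrite /X /lse_loss mulrA divff ?mul1r ?pnatr_eq0// enorm_sqr mulr_suml.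
    by apply: eq_bigr => i _; rewrite uE !mxE expr_div_n.
  have basic : \sum_(i < n.+1) u i ^+ 2 <= \sum_(i < n.+1) g w i * u i.
    have := lse_basic_inequality (\row_i z i w) ct; rewrite -/y.
    rewrite -(ler_pM2r (_ : 0 < (sigma ^+ 2)^-1)) ?invr_gt0 ?exprn_gt0//
      !mulr_suml.
    rewrite (eq_bigr (fun i : 'I_n.+1 => u i ^+ 2)); last first.
      by move=> i _; rewrite uE expr_div_n.
    rewrite [in X in _ <= X -> _](eq_bigr (fun i : 'I_n.+1 => g w i * u i))//.
    by move=> i _; rewrite uE /g inord_val mxE; field.
  (* The perturbation in the bias bound is the error u itself, so the estimate for t bounds t^2 by
     an expression containing t. *)
  pose t := Num.sqrt (X w).
  have X0 : 0 <= X w by rewrite XE sumr_ge0// => i _; exact: sqr_ge0.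
  have t0 : 0 <= t by exact: sqrtr_ge0.
  have tX : t ^+ 2 = X w by rewrite sqr_sqrtr.
  have bias := Ebias f f0 t cf cf0 t0 f0V.
  have {}bias := frame_basic_bound Eker basic (bias _).
  rewrite tX XE in bias; have {}bias := bias (lexx _).
  rewrite -XE -tX in bias.
  set S := \sum_(e <- E) _ in bias.
  (* Solve t^2 <= S + 2 C (M0 + t) with 4 C t <= t^2 + 4 C^2; M >= 1 absorbs the constant 4 C^2. *)
  have XS : X w - 4 * (C + C ^+ 2) * M <= 2 * S.
    have h1 := sqr_ge0 (t - 2 * C).
    have h2 : C * M0 <= C * M by rewrite ler_wpM2l.
    have h3 : C ^+ 2 * 1 <= C ^+ 2 * M by rewrite ler_wpM2l// sqr_ge0.
    by rewrite -tX; move: bias h1 h2 h3; clear; lra.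
  apply: (@le_trans _ _ (expR (2 / 17 * S))).
    by rewrite ler_expR; lra.
  rewrite /S mulr_sumr expR_sum /G.
  elim: (E) E0 => [|e E' ih] /=; first by rewrite !big_nil.
  move=> /andP[e0 /ih hE]; rewrite !big_cons; apply: ler_pM => //.
  - by apply: prodr_ge0 => ? _; exact: expR_ge0.
  - exact: expR_threshold_le.
pose e0 : (nat -> R) * R := (fun=> 0, 0).
pose wv j w := ip n.+1 (nth e0 E j).1 (g w).
pose bv j := expR (- (2 / 17 * (nth e0 E j).2 ^+ 2)).
have mg x : measurable_fun setT (fun w => g w x) by apply: measurable_funM.
have mwv j : measurable_fun setT (wv j).
  by apply: measurable_sum => x; apply: measurable_funM.
have GE w : G w = \prod_(j < size E) (1 + bv j * expR (2 / 17 * wv j w ^+ 2)).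
  by rewrite /G (big_nth e0) big_mkord.
have subg (s : nat -> R) : (\int[P]_w (expR (\sum_(j < size E) s j * wv j
  w))%:E <=
    (expR ((\sum_(j < size E) s j ^+ 2) / 2))%:E)%E.
  (* A combination of wavelet coefficients of the noise is linear in z; synthesis being a
     contraction, its variance is at most the sum of the s_j^2. *)
  pose c (i : 'I_n.+1) := (\sum_(j < size E) s j * (nth e0 E j).1 i) / sigma.
  have cE w : \sum_(j < size E) s j * wv j w = \sum_i c i * z i w.
    rewrite /wv /ip; under eq_bigr do rewrite mulr_sumr.
    rewrite exchange_big /=; apply: eq_bigr => i _.
    rewrite /c !mulr_suml; apply: eq_bigr => j _.
    by rewrite /g inord_val; field.
  under eq_integral do rewrite cE.
  rewrite (gaussian_linear_mgf _ s0' iidz) lee_fin ler_expR ler_pM2r//.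
  rewrite mulr_sumr; apply: le_trans (frame_synthesis_le s e0 Eker).
  by apply: ler_sum => i _; rewrite -exprMn /c mulrC divfK.
have Gint : (\int[P]_w (G w)%:E <= (\prod_(j < size E) (1 + K * bv j))%:E)%E.
  under eq_integral do rewrite GE.
  by apply: HK => // j; exact: expR_ge0.
apply: (@le_trans _ _ (\int[P]_w (G w)%:E)%E).
  apply: ge0_le_integral => //.
  - apply/measurable_EFinP; apply: measurableT_comp => //.
    apply: measurable_funM => //; apply: measurable_funB => //.
    apply: measurable_funM => //; apply: measurable_funM => //.
    exact: measurable_lse_loss.
  - apply/measurable_EFinP.
    rewrite (_ : G = fun w => \prod_(j < size E) (1 + bv j * expR (2 / 17 * wv
      j w ^+ 2))).
      apply: measurable_prod => j _; apply: measurable_funD => //.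
      apply: measurable_funM => //; apply: measurableT_comp => //.
      by apply: measurable_funM => //; exact: measurable_funX.
    by apply/funext => w; exact: GE.
  - by move=> w _; rewrite lee_fin; exact: pointwise.
apply: le_trans Gint _; rewrite lee_fin.
(* By 1 + x <= exp x the product becomes the exponential of the count of the frame. *)
apply: (@le_trans _ _ (expR (K * \sum_(e <- E) expR (- (2 / 17 * e.2 ^+ 2))))).
  rewrite (big_nth e0) big_mkord mulr_sumr expR_sum; apply: ler_prod => j _.
  by rewrite addr_ge0 ?mulr_ge0 ?expR_ge0//= expR_ge1Dx.
rewrite ler_expR -mulrA; apply: ler_wpM2l => //.
apply: le_trans (ler_wpM2l C0 M0M).
by apply: (Ecount (fun x => expR (- (2 / 17 * x ^+ 2)))) => i;
  exact: expR_sqr_le_quarter.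
Qed.

Lemma rate_identity (R : realType) (n : nat) (sigma s : R) : 0 < sigma -> 0
  <= s ->
  n.+1%:R^-1 * sigma ^+ 2 * (n.+1%:R * ((s + sigma) / sigma) ^+ 2) `^ (1 / 5) =
  sigma `^ (8 / 5) * (s + sigma) `^ (2 / 5) * n.+1%:R `^ (- (4 / 5)).
Proof.
move=> s0 sp0.
have sg0 : sigma != 0 by rewrite gt_eqF.
have n0 : n.+1%:R != 0 :> R by rewrite pnatr_eq0.
have ss0 : 0 <= s + sigma by rewrite addr_ge0// ltW.
rewrite powRM ?exprn_ge0 ?divr_ge0 ?(ltW s0)//.
rewrite -(@powR_mulrn _ ((s + sigma) / sigma) 2) ?divr_ge0 ?(ltW s0)//.
rewrite -powRrM (_ : 2%:R * (1 / 5) = 2 / 5); last by field.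
rewrite powRM ?invr_ge0 ?(ltW s0)// -(powR_inv1 (ltW s0)) -powRrM.
rewrite -(@powR_inv1 _ n.+1%:R)// -(powR_mulrn 2 (ltW s0)).
rewrite (_ : 8 / 5 = 2%:R + -1 * (2 / 5)); last by field.
rewrite (_ : - (4 / 5) = -1 + 1 / 5); last by field.
rewrite !powRD ?n0 ?sg0 ?implybT//; ring.
Qed.

Theorem theorem2p1 (R : realType) :
  exists C : R, 0 < C /\
    forall (n : nat) (sigma : R) (theta : 'rV[R]_n.+1)
      (d : measure_display) (T : measurableType d) (P : probability T R)
      (z : 'I_n.+1 -> {RV P >-> R}),
      0 < sigma -> concave_cone theta -> iid_gaussian sigma z ->
      (forall x : R, 0 < x ->
        ((1 - expR (- x) - expR (- (x ^+ 2 / 16)))%:E <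
         P [set w | (lse_loss theta z w <=
              n.+1%:R^-1 * (sigma ^+ 2 * (2 + 17 * x)) +
              C * (sigma `^ (8 / 5)) *
              ((spread (theta *m (1%:M - PL R n.+1))
                + sigma) `^ (2 / 5)) *
              (n.+1%:R `^ (- (4 / 5))))%R])%E) /\
      (lse_risk theta z <=
        (C * (sigma `^ (8 / 5)) *
         ((spread (theta *m (1%:M - PL R n.+1))
           + sigma) `^ (2 / 5)) *
         (n.+1%:R `^ (- (4 / 5)))
         + 2 * sigma ^+ 2 / n.+1%:R)%:E)%E.
Proof.
have [C1 [C2 [C10 C20 HC]]] := lse_expmoment R.
have C0 : 0 < C1 + 17 * C2 + 17 by rewrite ltr_wpDl// addr_ge0// mulr_ge0.
(* C1 and 17 C2 come from the exponential moment; the last 17 pays for the additive constant in the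
   mean, since M >= 1. *)
exists (C1 + 17 * C2 + 17); split => //.
move=> n sigma theta d T P z s0 ct iidz.
set C := C1 + 17 * C2 + 17 in C0 *.
set s := spread _; pose M := (n.+1%:R * ((s + sigma) / sigma) ^+ 2) `^ (1 / 5).
have sp0 : 0 <= s by have := spread_ge (theta *m (1%:M - PL R n.+1)) 0 0;
  rewrite subrr normr0.
have rate : C * sigma `^ (8 / 5) * (s + sigma) `^ (2 / 5) * n.+1%:R `^ (- (4 /
  5)) =
    n.+1%:R^-1 * (sigma ^+ 2 * (C * M)).
  have := rate_identity n s0 sp0; rewrite -/M => h.
  rewrite -!mulrA [sigma `^ _ * _]mulrA -h; ring.
have n0 : 0 < n.+1%:R :> R by rewrite ltr0n.
have M1 : 1 <= M.
  have sv : 1 <= (s + sigma) / sigma by rewrite ler_pdivlMr// mul1r lerDr.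
  have nV1 : 1 <= n.+1%:R * ((s + sigma) / sigma) ^+ 2.
    by rewrite mulr_ege1// ?ler1n// exprn_ege1.
  by have := ler_powR nV1 (_ : 0 <= 1 / 5); rewrite powRr0; apply; lra.
pose X w := n.+1%:R * lse_loss theta z w / sigma ^+ 2.
have mX : measurable_fun setT X.
  by apply: measurable_funM => //; apply: measurable_funM => //;
    exact: measurable_lse_loss.
have lossE w : lse_loss theta z w = n.+1%:R^-1 * (sigma ^+ 2 * X w).
  by rewrite /X; field; rewrite !gt_eqF.
have HX := HC n sigma theta d T P z _ M s0 ct iidz erefl erefl.
rewrite rate; split => [x x0|].
  have := expmoment_tail x mX HX; set S := [set w | _] => hS.
  set S' := [set w | _].
  have mS b (f : T -> R) : measurable_fun setT f -> measurable [set w | f w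
    <= b].
    move=> mf; rewrite -[X in measurable X]setTI.
    rewrite (_ : [set w | f w <= b] = f @^-1` `]-oo, b]%classic).
      by apply: mf => //; exact: measurable_itv.
    by apply/seteqP; split => w /=; rewrite in_itv.
  (* The positive term exp (- x^2 / 16) turns the weak tail bound into a strict one. *)
  apply: (@lt_le_trans _ _ (1 - expR (- x))%:E).
    by rewrite lte_fin ltrBlDr ltrDl expR_gt0.
  apply: le_trans hS _; apply: le_measure; rewrite ?inE.
  - exact: mS.
  - by apply: mS; exact: measurable_lse_loss.
  - move=> w; rewrite /S /S' /= => Xw.
    rewrite lossE -mulrDr -mulrDr.
    do 2! (rewrite ler_pM2l ?invr_gt0 ?exprn_gt0//).
    by move: Xw; rewrite /C; lra.
rewrite /lse_risk unlock.
have X0 w : 0 <= X w.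
  by rewrite /X /lse_loss enorm_sqr divr_ge0 ?sqr_ge0// !mulr_ge0// sumr_ge0//
    => i _; exact: sqr_ge0.
have AB0 : 0 <= C1 * M + 17 * (C2 * M).
  by rewrite addr_ge0// !mulr_ge0// (le_trans _ M1).
have hX := expmoment_mean mX HX X0 AB0.
under eq_integral do rewrite lossE mulrA EFinM.
rewrite ge0_integralZl//; last 3 first.
- exact/measurable_EFinP.
- by move=> w _; rewrite lee_fin.
- by rewrite lee_fin mulr_ge0 ?invr_ge0 ?sqr_ge0.
apply: (@le_trans _ _ ((n.+1%:R^-1 * sigma ^+ 2)%:E * (C1 * M + 17 * (C2 * M) +
  17)%:E)%E).
  by rewrite lee_wpmul2l// lee_fin mulr_ge0 ?invr_ge0 ?sqr_ge0.
rewrite -EFinM lee_fin.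
apply: (@le_trans _ _ (n.+1%:R^-1 * (sigma ^+ 2 * (C * M)))).
  rewrite [leRHS]mulrA ler_pM2l ?mulr_gt0 ?invr_gt0 ?exprn_gt0//.
  by rewrite /C; lra.
by rewrite lerDl divr_ge0// mulr_ge0// sqr_ge0.
Qed.
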